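(* Let $m\ge2$ be an integer and let $X_0^*$ be a random variable with values in $\{1,2,\dots\}$ such that $\mathbf P(X_0^*=k)\sim c_0\, m^{-k}k^{-2}$ as $k\to\infty$, for some constant $0<c_0<\infty$. Then $p_c(X_0^* )=0$ and $$F_\infty(p)=\exp\Big(-\mathrm e^{(C+o(1))/p}\Big),\qquad p\downarrow 0,$$ where $C:=\frac{1}{(m-1)c_0}$.
   Context: Recursive system: fix an integer $m\ge2$. For a $\mathbb Z_+$-valued random variable $X_0$, define recursively the laws of $X_n$, $n\ge0$, by requiring that $X_{n+1}$ has the law of $(X_{n,1}+\cdots+X_{n,m}-1)^+$, where $X_{n,1},\dots,X_{n,m}$ are independent copies of $X_n$. The free energy is $F_\infty:=\lim_{n\to\infty}\mathbf E(X_n)/m^n$. Parametrized family: given $X_0^*$ and $p\in[0,1]$, let $X_0$ have law $(1-p)\delta_0+p\,P_{X_0^*}$, and let $F_\infty(p)$ denote the free energy of the resulting system. $p_c(X_0^* )$ is the threshold such that $F_\infty(p)>0$ for $p>p_c$ and $F_\infty(p)=0$ for $p<p_c$; it equals $\frac{1}{1+\mathbf E\{[(m-1)X_0^*-1]m^{X_0^*}\}}$, interpreted as $0$ when this expectation is infinite. *)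

(* Defs.v *)
(* laws on Z_+ are represented by probability mass functions nat -> R. *)
From Stdlib Require Import Reals Lra.
Open Scope R_scope.

Definition conv (f g : nat -> R) (n : nat) : R :=
  sum_f_R0 (fun k => f k * g (n - k)%nat) n.

Definition dirac0 (n : nat) : R := match n with O => 1 | S _ => 0 end.

Fixpoint conv_pow (f : nat -> R) (j : nat) : nat -> R :=
  match j with
  | O => dirac0
  | S j' => conv f (conv_pow f j')
  end.

(* Law of (X_1 + ... + X_m - 1)^+ where X_i are i.i.d. with law f. *)
Definition step (m : nat) (f : nat -> R) (n : nat) : R :=
  let s := conv_pow f m in
  match n with
  | O => s 0%nat + s 1%nat
  | S n' => s (S (S n'))
  end.

Fixpoint law (m : nat) (f0 : nat -> R) (n : nat) : nat -> R :=
  match n with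
  | O => f0
  | S n' => step m (law m f0 n')
  end.

Definition has_mean (f : nat -> R) (mu : R) : Prop :=
  infinite_sum (fun k => INR k * f k) mu.

Definition free_energy (m : nat) (f0 : nat -> R) (F : R) : Prop :=
  exists mu : nat -> R,
    (forall n, has_mean (law m f0 n) (mu n)) /\
    Un_cv (fun n => mu n / INR m ^ n) F.

Definition mix (p : R) (q : nat -> R) (k : nat) : R :=
  (1 - p) * dirac0 k + p * q k.

(* Main.v *)
(* Write [G(s)] and [H(s)] for [E s^X] and [E (X s^X)].  One step of the recursion
   multiplies the drift [(s - 1) H - G] by [G^(m-1)] when [s = m], up to a term of
   known sign when [s < m].  With [s = m (1 - 1/L)] the initial drift is about
   [p (m - 1) c0 ln L - 1], which changes sign at [L = e^(C/p)].

   Upper bound: if it is negative, it stays so for about [L] steps; this bounds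
   [E X_n], and [F <= E X_n / m^n] gives [F <= m^(-L^(1+o(1)))].

   Lower bound: if [F < m^(-R)], then [P (X_n >= k) <= m^(4-k)] whenever
   [n + k <= R], for otherwise [E X_(n+k) >= 2] and [F >= m^(-(n+k))].  Truncate the
   system at a height [N = L^(1+o(1))], which costs the drift a negligible amount at
   each step.  A positive drift on [[0, N]] forces [G - 1] to be at least of order
   [1/N], so the drift grows exponentially on the time scale [N], whereas the tail
   estimate bounds it by a power of [N]; hence [R <= N^(1+o(1))]. *)
Require Import Defs.
From Stdlib Require Import Reals Lra Lia.
From Coquelicot Require Import Rcomplements Hierarchy Series.
Open Scope R_scope.

(** * Series and generating functions *)

(** At [s = m] the initial law is borderline: [k m^k P(X_0 = k)] is about [p c0 / k], so [H]
    diverges, but only logarithmically, while [G] stays at [1 + O(p)]. Moving [s] to [m (1 - 1/L)]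
    cuts the divergence off at [k = L]; balancing [p (m - 1) c0 ln L] against 1 is the origin of
    [C].

    The price is the ratio [m / s] that each step puts in front of [H]. It favours the lower bound
    and is simply discarded there. In the upper bound it accumulates, so the number of steps must be
    a small fixed fraction of [L].

    In the lower bound [s < m] has a second role. The tail estimate only keeps [m^k P(X_n = k)]
    bounded, so at [s = m] cutting at height [N] could cost a power of [N] per step; with [s < m]
    the cost carries the factor [(1 - 1/L)^N], which beats any fixed power of [L] once [N] is a
    suitable multiple of [L ln L].

    Since [ln L] is of order [1/p], constant factors and powers of [ln L] in the number of steps
    disappear in [e^(o(1)/p)], provided that all thresholds are chosen before [p]. This is why the
    estimates at scale [L] are uniform in [p]. *)

Lemma series_linear (a b : nat -> R) (c d la lb : R) :
  is_series a la -> is_series b lb ->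
  is_series (fun k => c * a k + d * b k) (c * la + d * lb).
Proof.
  intros Ha Hb.
  exact (is_series_plus _ _ _ _ (is_series_scal_l c a la Ha)
           (is_series_scal_l d b lb Hb)).
Qed.

Lemma series_ext (a b : nat -> R) (la lb : R) :
  (forall k, a k = b k) -> la = lb -> is_series a la -> is_series b lb.
Proof. intros H <- Ha. exact (is_series_ext a b la H Ha). Qed.

Lemma series_cv (a : nat -> R) (l : R) :
  is_series a l -> Un_cv (sum_f_R0 a) l.
Proof. intros H. exact (proj1 (is_series_Reals a l) H). Qed.

Lemma series_unique (a : nat -> R) (l l' : R) :
  is_series a l -> is_series a l' -> l = l'.
Proof.
  intros H H'. exact (UL_sequence _ _ _ (series_cv _ _ H) (series_cv _ _ H')).
Qed.

Lemma Un_cv_le (u v : nat -> R) (l l' : R) (n0 : nat) :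
  (forall n, (n0 <= n)%nat -> u n <= v n) -> Un_cv u l -> Un_cv v l' -> l <= l'.
Proof.
  intros H Hu Hv. destruct (Rle_dec l l') as [|Hn]; [assumption|exfalso].
  destruct (Hu ((l - l') / 2)) as [N1 H1]; [lra|].
  destruct (Hv ((l - l') / 2)) as [N2 H2]; [lra|].
  specialize (H1 (N1 + N2 + n0)%nat ltac:(lia)).
  specialize (H2 (N1 + N2 + n0)%nat ltac:(lia)).
  specialize (H (N1 + N2 + n0)%nat ltac:(lia)).
  unfold Rdist in *. apply Rabs_def2 in H1. apply Rabs_def2 in H2. lra.
Qed.

Lemma Un_cv_const (c : R) : Un_cv (fun _ => c) c.
Proof.
  intros e He. exists 0%nat. intros n _. unfold Rdist.
  rewrite Rminus_diag, Rabs_R0. exact He.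
Qed.

Lemma series_le (a b : nat -> R) (la lb : R) :
  (forall k, a k <= b k) -> is_series a la -> is_series b lb -> la <= lb.
Proof.
  intros H Ha Hb.
  apply (Un_cv_le (sum_f_R0 a) (sum_f_R0 b) la lb 0); try apply series_cv; auto.
  intros n _. apply sum_Rle. auto.
Qed.

Lemma series_le_bound (a : nat -> R) (l M : R) :
  (forall n, sum_f_R0 a n <= M) -> is_series a l -> l <= M.
Proof.
  intros H Ha.
  apply (Un_cv_le (sum_f_R0 a) (fun _ => M) l M 0).
  - auto.
  - apply series_cv, Ha.
  - apply Un_cv_const.
Qed.

Lemma series_ge_partial (a : nat -> R) (l : R) (n : nat) :
  (forall k, 0 <= a k) -> is_series a l -> sum_f_R0 a n <= l.
Proof.
  intros H Ha.
  apply (growing_ineq (sum_f_R0 a)); [|apply series_cv, Ha].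
  intros k. simpl. specialize (H (S k)). lra.
Qed.

Lemma sum_f_R0_finite (a : nat -> R) (N n : nat) :
  (forall k, (N < k)%nat -> a k = 0) -> (N <= n)%nat ->
  sum_f_R0 a n = sum_f_R0 a N.
Proof.
  intros H Hn. induction Hn as [|n Hn IH]; [reflexivity|].
  simpl. rewrite IH, H; [ring|lia].
Qed.

Lemma series_finite (a : nat -> R) (N : nat) :
  (forall k, (N < k)%nat -> a k = 0) -> is_series a (sum_f_R0 a N).
Proof.
  intros H. apply is_series_Reals. intros e He. exists N. intros n Hn.
  unfold Rdist. rewrite (sum_f_R0_finite a N n H Hn), Rminus_diag, Rabs_R0.
  exact He.
Qed.

Lemma series_ge0_ex_le (a b : nat -> R) (lb : R) :
  (forall k, 0 <= a k <= b k) -> is_series b lb -> exists la, is_series a la.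
Proof.
  intros H Hb.
  assert (He : ex_series a).
  { apply (ex_series_le a b); [|exists lb; exact Hb].
    intros n. unfold norm; simpl. unfold abs; simpl.
    rewrite Rabs_pos_eq; apply H. }
  destruct He as [l Hl]. exists l. exact Hl.
Qed.

(** * Convolution powers and one step of the recursion *)

Lemma conv_ge0 (f g : nat -> R) :
  (forall k, 0 <= f k) -> (forall k, 0 <= g k) -> forall k, 0 <= conv f g k.
Proof.
  intros Hf Hg k. unfold conv. apply cond_pos_sum. intros i.
  apply Rmult_le_pos; auto.
Qed.

Lemma dirac0_ge0 (k : nat) : 0 <= dirac0 k.
Proof. destruct k; simpl; lra. Qed.

Lemma conv_pow_ge0 (f : nat -> R) (j : nat) :
  (forall k, 0 <= f k) -> forall k, 0 <= conv_pow f j k.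
Proof.
  intros Hf. induction j as [|j IH]; simpl; [exact dirac0_ge0|].
  apply conv_ge0; auto.
Qed.

Lemma step_ge0 (m : nat) (f : nat -> R) :
  (forall k, 0 <= f k) -> forall k, 0 <= step m f k.
Proof.
  intros Hf k. pose proof (conv_pow_ge0 f m Hf) as H.
  destruct k; simpl; [|apply H].
  pose proof (H 0%nat). pose proof (H 1%nat). lra.
Qed.

Lemma conv_pow_0 (f : nat -> R) (j : nat) : conv_pow f j 0%nat = f 0%nat ^ j.
Proof.
  induction j as [|j IH]; simpl; [reflexivity|].
  unfold conv; simpl. rewrite IH. reflexivity.
Qed.

(** A relation, so that convergence of both series is part of the assertion. [H] is [s G'(s)], which
    is why it obeys the Leibniz rule under convolution. *)
Definition gf (f : nat -> R) (s G H : R) : Prop :=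
  is_series (fun k => f k * s ^ k) G /\
  is_series (fun k => INR k * (f k * s ^ k)) H.

Lemma gf_dirac0 (s : R) : gf dirac0 s 1 0.
Proof.
  split.
  - eapply series_ext;
      [reflexivity| |apply (series_finite _ 0)]; simpl; [ring|].
    intros [|k] Hk; [lia|simpl; ring].
  - eapply series_ext;
      [reflexivity| |apply (series_finite _ 0)]; simpl; [ring|].
    intros [|k] Hk; [lia|simpl; ring].
Qed.

Lemma gf_linear (f g : nat -> R) (s c d G H G' H' : R) :
  gf f s G H -> gf g s G' H' ->
  gf (fun k => c * f k + d * g k) s (c * G + d * G') (c * H + d * H').
Proof.
  intros [H1 H2] [H3 H4]. split.
  - eapply series_ext; [|reflexivity|exact (series_linear _ _ c d _ _ H1 H3)].
    intros k; simpl; ring.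
  - eapply series_ext; [|reflexivity|exact (series_linear _ _ c d _ _ H2 H4)].
    intros k; simpl; ring.
Qed.

Lemma gf_ext (f g : nat -> R) (s G H G' H' : R) :
  (forall k, f k = g k) -> G = G' -> H = H' -> gf f s G H -> gf g s G' H'.
Proof.
  intros E <- <- [H1 H2]. split.
  - eapply series_ext; [|reflexivity|exact H1]. intros k; simpl; now rewrite E.
  - eapply series_ext; [|reflexivity|exact H2]. intros k; simpl; now rewrite E.
Qed.

(** Cauchy products; for [H] the weight is split as [n = k + (n - k)]. Nonnegativity justifies
    multiplying the series. *)
Lemma gf_conv (f g : nat -> R) (s G H G' H' : R) :
  (forall k, 0 <= f k) -> (forall k, 0 <= g k) -> 0 <= s ->
  gf f s G H -> gf g s G' H' -> gf (conv f g) s (G * G') (H * G' + G * H').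
Proof.
  intros Hf Hg Hs [H1 H2] [H3 H4].
  assert (Hfs : forall k, 0 <= f k * s ^ k)
    by (intros k; apply Rmult_le_pos; [auto|now apply pow_le]).
  assert (Hgs : forall k, 0 <= g k * s ^ k)
    by (intros k; apply Rmult_le_pos; [auto|now apply pow_le]).
  assert (Hfk : forall k, 0 <= INR k * (f k * s ^ k))
    by (intros k; apply Rmult_le_pos; [apply pos_INR|auto]).
  assert (Hgk : forall k, 0 <= INR k * (g k * s ^ k))
    by (intros k; apply Rmult_le_pos; [apply pos_INR|auto]).
  assert (Hp : forall n k, (k <= n)%nat ->  s ^ n = s ^ k * s ^ (n - k)).
  { intros n k Hk. rewrite <- pow_add. f_equal. lia. }
  split.
  - eapply series_ext;
      [|reflexivity|exact (is_series_mult_pos _ _ _ _ H1 H3 Hfs Hgs)].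
    intros n; simpl. unfold conv. rewrite Rmult_comm, scal_sum.
    apply sum_eq. intros k Hk. rewrite (Hp n k Hk). ring.
  - pose proof (is_series_mult_pos _ _ _ _ H2 H3 Hfk Hgs) as S1.
    pose proof (is_series_mult_pos _ _ _ _ H1 H4 Hfs Hgk) as S2.
    eapply series_ext; [| |exact (series_linear _ _ 1 1 _ _ S1 S2)]; [|ring].
    intros n; simpl. rewrite 2!Rmult_1_l, <- sum_plus. unfold conv.
    rewrite (Rmult_comm _ (s ^ n)), scal_sum, scal_sum.
    apply sum_eq. intros k Hk. rewrite (Hp n k Hk).
    rewrite minus_INR by exact Hk. ring.
Qed.

Lemma gf_conv_pow (f : nat -> R) (s G H : R) (j : nat) :
  (forall k, 0 <= f k) -> 0 <= s -> gf f s G H ->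
  gf (conv_pow f j) s (G ^ j) (INR j * G ^ pred j * H).
Proof.
  intros Hf Hs HG. induction j as [|j IH].
  - eapply gf_ext; [reflexivity| | |apply gf_dirac0]; simpl; ring.
  - eapply gf_ext;
      [reflexivity| | |exact (gf_conv f _ s _ _ _ _ Hf (conv_pow_ge0 f j Hf) Hs HG IH)].
    + reflexivity.
    + rewrite S_INR. destruct j; simpl; ring.
Qed.

(** Subtracting 1 divides by [s]. The positive part keeps the atom [f 0 ^ m] at 0 instead of sending
    it to -1, which accounts for the correction terms. *)
Lemma gf_step (m : nat) (f : nat -> R) (s G H : R) :
  (forall k, 0 <= f k) -> 0 < s -> gf f s G H ->
  gf (step m f) s ((G ^ m + (s - 1) * f 0%nat ^ m) / s)
     ((INR m * G ^ pred m * H - G ^ m + f 0%nat ^ m) / s).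
Proof.
  intros Hf Hs HG.
  destruct (gf_conv_pow f s G H m Hf (Rlt_le _ _ Hs) HG) as [H1 H2].
  destruct (gf_dirac0 s) as [D1 D2].
  assert (I1 := is_series_incr_1 (fun k => conv_pow f m k * s ^ k)
    (G ^ m - f 0%nat ^ m)).
  assert (I2 := is_series_incr_1 (fun k => INR k * (conv_pow f m k * s ^ k))
    (INR m * G ^ pred m * H)).
  assert (J1 : is_series (fun k => conv_pow f m (S k) * s ^ (S k)) (G ^ m - f 0%nat ^ m)).
  { apply I1. eapply series_ext; [reflexivity| |exact H1].
    unfold plus; simpl. rewrite conv_pow_0. ring. }
  assert (J2 : is_series (fun k => INR (S k) * (conv_pow f m (S k) * s ^ (S k)))
    (INR m * G ^ pred m * H)).
  { apply I2. eapply series_ext; [reflexivity| |exact H2].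
    unfold plus; simpl. ring. }
  clear I1 I2. split.
  - eapply series_ext; [| |exact (series_linear _ _ (/ s) (f 0%nat ^ m) _ _ J1 D1)].
    + intros [|k]; unfold step; simpl.
      * rewrite conv_pow_0. field. lra.
      * field. lra.
    + field. lra.
  - eapply series_ext; [| |exact (series_linear _ _ (/ s) (- / s) _ _ J2 J1)].
    + intros [|k]; unfold step.
      * simpl. ring.
      * rewrite (S_INR (S k)). simpl pow. field. lra.
    + field. lra.
Qed.

Definition pmf (f : nat -> R) : Prop := (forall k, 0 <= f k) /\ is_series f 1.

Lemma gf_pmf (f : nat -> R) (mu : R) :
  pmf f -> has_mean f mu -> gf f 1 1 mu.
Proof.
  intros [_ Hf] Hm. split.
  - eapply series_ext; [|reflexivity|exact Hf]. intros k; simpl. rewrite pow1; ring.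
  - apply is_series_Reals in Hm. eapply series_ext; [|reflexivity|exact Hm].
    intros k; simpl. rewrite pow1; ring.
Qed.

Lemma gf_1_pmf (f : nat -> R) (mu : R) :
  (forall k, 0 <= f k) -> gf f 1 1 mu -> pmf f /\ has_mean f mu.
Proof.
  intros H0 [Hf Hm]. repeat split.
  - exact H0.
  - eapply series_ext; [|reflexivity|exact Hf]. intros k; simpl. rewrite pow1; ring.
  - apply is_series_Reals. eapply series_ext; [|reflexivity|exact Hm].
    intros k; simpl. rewrite pow1; ring.
Qed.

Lemma mean_step (m : nat) (f : nat -> R) (mu : R) :
  pmf f -> has_mean f mu ->
  pmf (step m f) /\ has_mean (step m f) (INR m * mu - 1 + f 0%nat ^ m).
Proof.
  intros Hf Hm. apply gf_1_pmf; [apply step_ge0, Hf|].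
  eapply gf_ext; [reflexivity| | |
    exact (gf_step m f 1 1 mu (proj1 Hf) Rlt_0_1 (gf_pmf f mu Hf Hm))];
    rewrite ?pow1; field.
Qed.

Lemma has_mean_unique (f : nat -> R) (mu mu' : R) :
  has_mean f mu -> has_mean f mu' -> mu = mu'.
Proof. apply uniqueness_sum. Qed.

Lemma pmf_le1 (f : nat -> R) (n : nat) : pmf f -> sum_f_R0 f n <= 1.
Proof. intros [H0 H1]. now apply series_ge_partial. Qed.

Lemma sum_f_R0_ge_term (f : nat -> R) (k n : nat) :
  (forall k, 0 <= f k) -> (k <= n)%nat -> f k <= sum_f_R0 f n.
Proof.
  intros H0 Hk. induction Hk as [|n Hk IH].
  - destruct k; simpl; [lra|]. pose proof (cond_pos_sum f k H0). lra.
  - simpl. specialize (H0 (S n)). lra.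
Qed.

Lemma pmf_term_le1 (f : nat -> R) (k : nat) : pmf f -> f k <= 1.
Proof.
  intros Hf. apply Rle_trans with (sum_f_R0 f k); [|now apply pmf_le1].
  apply sum_f_R0_ge_term; [apply Hf|lia].
Qed.

Lemma has_mean_ge0 (f : nat -> R) (mu : R) :
  (forall k, 0 <= f k) -> has_mean f mu -> 0 <= mu.
Proof.
  intros H0 Hm. apply is_series_Reals in Hm.
  apply Rle_trans with (2 := series_ge_partial _ _ 0
    (fun k => Rmult_le_pos _ _ (pos_INR k) (H0 k)) Hm).
  simpl; lra.
Qed.

Lemma markov (f : nat -> R) (mu : R) (L : nat) :
  pmf f -> has_mean f mu -> INR (S L) * (1 - sum_f_R0 f L) <= mu.
Proof.
  intros Hf Hm. apply is_series_Reals in Hm.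
  set (g := fun k => if Nat.leb k L then f k else 0).
  assert (Hg : is_series g (sum_f_R0 f L)).
  { eapply series_ext; [reflexivity| |apply (series_finite g L)].
    - apply sum_eq. intros i Hi. unfold g.
      destruct (Nat.leb_spec i L); [reflexivity|lia].
    - intros k Hk. unfold g. destruct (Nat.leb_spec k L); [lia|reflexivity]. }
  pose proof (series_linear _ _ (INR (S L)) (- INR (S L)) _ _ (proj2 Hf) Hg) as HS.
  pose proof (fun H => series_le _ _ _ _ H HS Hm) as Hle. simpl in Hle.
  match goal with |- ?x <= _ => replace x with
    (INR (S L) * 1 + - INR (S L) * sum_f_R0 f L) by ring end.
  apply Hle. intros k. unfold g. pose proof (proj1 Hf k) as Hk.
  change (match L with 0%nat => 1 | S _ => INR L + 1 end) with (INR (S L)).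
  destruct (Nat.leb_spec k L).
  - pose proof (Rmult_le_pos _ _ (pos_INR k) Hk). lra.
  - assert (INR (S L) <= INR k) by (apply le_INR; lia). nra.
Qed.

(** * The limit of [E X_n / m^n] and its two one-sided bounds *)

Section FreeEnergy.
Variables (m : nat) (f0 : nat -> R).
Hypothesis (Hm : (2 <= m)%nat) (Hf0 : pmf f0).

Lemma INR_m_ge2 : 2 <= INR m.
Proof. apply (le_INR 2) in Hm. simpl in Hm. lra. Qed.

Lemma law_mean (mu : nat -> R) :
  (forall n, has_mean (law m f0 n) (mu n)) ->
  forall n, pmf (law m f0 n) /\
    mu (S n) = INR m * mu n - 1 + law m f0 n 0%nat ^ m.
Proof.
  intros Hmu.
  assert (Hp : forall n, pmf (law m f0 n)).
  { induction n as [|n IH]; [exact Hf0|].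
    exact (proj1 (mean_step m _ _ IH (Hmu n))). }
  intros n. split; [apply Hp|].
  exact (has_mean_unique _ _ _ (Hmu (S n)) (proj2 (mean_step m _ _ (Hp n) (Hmu n)))).
Qed.

Lemma ratio_decreasing (mu : nat -> R) :
  (forall n, has_mean (law m f0 n) (mu n)) ->
  Un_decreasing (fun n => mu n / INR m ^ n).
Proof.
  intros Hmu n. destruct (law_mean mu Hmu n) as [Hp ->]. pose proof INR_m_ge2.
  assert (0 < INR m ^ n) by (apply pow_lt; lra).
  assert (law m f0 n 0%nat ^ m <= 1).
  { rewrite <- (pow1 m). apply pow_incr. split; [apply Hp|now apply pmf_term_le1]. }
  simpl. apply Rmult_le_reg_r with (INR m * INR m ^ n); [nra|].
  replace (mu n / INR m ^ n * (INR m * INR m ^ n)) with (INR m * mu n) by (field; lra).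
  unfold Rdiv. rewrite Rmult_assoc, Rinv_l by nra. lra.
Qed.

Lemma free_energy_le (mu : nat -> R) (F : R) :
  (forall n, has_mean (law m f0 n) (mu n)) ->
  Un_cv (fun n => mu n / INR m ^ n) F ->
  forall n, F <= mu n / INR m ^ n.
Proof.
  intros Hmu HF. apply decreasing_ineq; [now apply ratio_decreasing|exact HF].
Qed.

(** The means satisfy [mu (n+1) >= m mu n - 1], and [1/(m-1)] is the fixed point of this affine map,
    so the shifted ratio is nondecreasing in [n]. *)
Lemma free_energy_ge (mu : nat -> R) (F : R) :
  (forall n, has_mean (law m f0 n) (mu n)) ->
  Un_cv (fun n => mu n / INR m ^ n) F ->
  forall n, (mu n - / (INR m - 1)) / INR m ^ n <= F.
Proof.
  intros Hmu HF n. pose proof INR_m_ge2.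
  assert (Hinv : 0 < / (INR m - 1)) by (apply Rinv_0_lt_compat; lra).
  apply (Un_cv_le (fun _ => (mu n - / (INR m - 1)) / INR m ^ n)
    (fun k => mu k / INR m ^ k) _ _ n); [|apply Un_cv_const|exact HF].
  intros k Hk.
  apply Rle_trans with ((mu k - / (INR m - 1)) / INR m ^ k).
  - induction Hk as [|k Hk IH]; [lra|].
    apply Rle_trans with (1 := IH).
    destruct (law_mean mu Hmu k) as [Hp ->].
    assert (0 < INR m ^ k) by (apply pow_lt; lra).
    assert (0 <= law m f0 k 0%nat ^ m) by (apply pow_le, Hp).
    simpl. apply Rmult_le_reg_r with (INR m * INR m ^ k); [nra|].
    replace ((mu k - / (INR m - 1)) / INR m ^ k * (INR m * INR m ^ k)) with
      (INR m * mu k - INR m * / (INR m - 1)) by (field; lra).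
    unfold Rdiv at 1. rewrite Rmult_assoc, Rinv_l by nra.
    assert (INR m * / (INR m - 1) = 1 + / (INR m - 1)) by (field; lra). lra.
  - unfold Rdiv. apply Rmult_le_compat_r; [|lra].
    apply Rlt_le, Rinv_0_lt_compat, pow_lt. lra.
Qed.

Lemma free_energy_ex (mu0 : R) :
  has_mean f0 mu0 -> exists F, free_energy m f0 F.
Proof.
  intros H0.
  set (mu := fix mu n := match n with 0%nat => mu0
    | S k => INR m * mu k - 1 + law m f0 k 0%nat ^ m end).
  assert (Hmu : forall n, pmf (law m f0 n) /\ has_mean (law m f0 n) (mu n)).
  { induction n as [|n [IH1 IH2]]; [split; [exact Hf0|exact H0]|].
    exact (mean_step m _ _ IH1 IH2). }
  destruct (decreasing_cv (fun n => mu n / INR m ^ n)) as [F HF].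
  - apply ratio_decreasing. apply Hmu.
  - exists 0. intros x [n ->]. unfold opp_seq.
    assert (0 <= mu n / INR m ^ n); [|lra].
    pose proof INR_m_ge2. apply Rdiv_le_0_compat; [|apply pow_lt; lra].
    destruct (Hmu n) as [Hp Hn]. exact (has_mean_ge0 _ _ (proj1 Hp) Hn).
  - exists F, mu. split; [apply Hmu|exact HF].
Qed.

End FreeEnergy.

(** * The upper bound at a fixed scale *)

Lemma gf_ge_mass (f : nat -> R) (s G H : R) :
  pmf f -> 1 <= s -> gf f s G H -> 1 <= G.
Proof.
  intros [H0 H1] Hs [HG _].
  apply (series_le _ _ _ _) with (2 := H1) (3 := HG).
  intros k. specialize (H0 k). pose proof (pow_R1_Rle s k Hs). nra.
Qed.

(* [(s - 1) H - G] is the functional of Collet, Eckmann, Glaser and Martin: it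
   is multiplied by [G ^ (m - 1)] at each step when [s = m]. *)
Lemma drift_step (m : nat) (s G H x : R) :
  (2 <= m)%nat -> 0 < s ->
  (s - 1) * ((INR m * G ^ pred m * H - G ^ m + x) / s)
    - (G ^ m + (s - 1) * x) / s
  = G ^ pred m * (INR m / s * ((s - 1) * H) - G).
Proof.
  intros Hm Hs. destruct m as [|m']; [lia|].
  change (G ^ S m') with (G * G ^ m'). change (pred (S m')) with m'.
  field. lra.
Qed.

(** For [s < m] the inequality [(s - 1) H <= G] alone is not propagated, because a step multiplies
    [H] by the extra ratio [m / s]. The initial slack [(m / s)^N] pays for [N] such losses. *)
Lemma subcritical_preserved (m : nat) (f0 : nat -> R) (s G0 H0 : R) (N : nat) :
  (2 <= m)%nat -> (forall n, pmf (law m f0 n)) -> 1 <= s <= INR m ->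
  gf f0 s G0 H0 -> (s - 1) * H0 * (INR m / s) ^ N <= G0 ->
  exists G H, gf (law m f0 N) s G H /\ (s - 1) * H <= G.
Proof.
  intros Hm Hlaw Hs HG0 Hsub.
  set (r := INR m / s) in *.
  assert (Hr : 1 <= r).
  { unfold r. apply Rmult_le_reg_r with s; [lra|].
    unfold Rdiv. rewrite Rmult_assoc, Rinv_l by lra. lra. }
  (* The power [r ^ (N - n)] is the slack still left at time [n]; each step consumes one factor. *)
  assert (K : forall n, (n <= N)%nat -> exists G H, gf (law m f0 n) s G H /\
    (s - 1) * H * r ^ (N - n) <= G).
  { induction n as [|n IH]; intros Hn.
    - exists G0, H0. rewrite Nat.sub_0_r. auto.
    - destruct IH as (G & H & HG & Hle); [lia|].
      pose proof (Hlaw n) as Hp.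
      assert (H1G := gf_ge_mass _ _ _ _ Hp (proj1 Hs) HG).
      pose proof (gf_step m _ s G H (proj1 Hp) ltac:(lra) HG) as HG'.
      eexists _, _. split; [exact HG'|].
      set (x := law m f0 n 0%nat ^ m) in *.
      pose proof (drift_step m s G H x Hm ltac:(lra)) as HD. fold r in HD.
      set (H' := (INR m * G ^ pred m * H - G ^ m + x) / s) in *.
      set (G' := (G ^ m + (s - 1) * x) / s) in *.
      assert (Hx : x <= G ^ m).
      { unfold x. apply pow_incr. split; [apply Hp|].
        apply Rle_trans with 1; [now apply pmf_term_le1|exact H1G]. }
      assert (HG'le : G' <= G ^ m).
      { unfold G'. apply Rmult_le_reg_r with s; [lra|].
        unfold Rdiv. rewrite Rmult_assoc, Rinv_l by lra. nra. }
      replace (N - n)%nat with (S (N - S n)) in Hle by lia.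
      simpl in Hle.
      set (t := r ^ (N - S n)) in *.
      assert (Ht : 1 <= t) by (apply pow_R1_Rle, Hr).
      assert (Hpow : G ^ m = G * G ^ pred m)
        by (destruct m; [lia|reflexivity]).
      assert (Hpos : 1 <= G ^ pred m) by (apply pow_R1_Rle, H1G).
      assert (E : (s - 1) * H' = G' + G ^ pred m * (r * ((s - 1) * H) - G))
        by lra.
      (* Multiplied by [t], the right side is at most [G' t + G^m (1 - t)] by the induction
         hypothesis, and this is at most [G'] because [G' <= G^m] and [t >= 1]. *)
      rewrite E.
      assert (G ^ pred m * (r * ((s - 1) * H) * t) <= G ^ pred m * G)
        by (apply Rmult_le_compat_l; lra).
      assert (G' * (t - 1) <= G ^ m * (t - 1))
        by (apply Rmult_le_compat_r; lra).
      rewrite Hpow in *. nra. }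
  destruct (K N (le_n N)) as (G & H & HG & Hle).
  rewrite Nat.sub_diag in Hle. simpl in Hle. exists G, H.
  split; [exact HG|lra].
Qed.

(** Combining [(s - 1) H <= G] with [2 G <= H + m] gives [(s - 3/2) H <= m/2]. With [s >= 7/4] this
    bounds [H], and hence [E X_N], by a multiple of [m]. *)
Lemma free_energy_upper (m : nat) (f0 : nat -> R) (s G0 H0 F : R) (N : nat) :
  (2 <= m)%nat -> pmf f0 -> 7 / 4 <= s <= INR m -> INR m - s <= 1 / 4 ->
  gf f0 s G0 H0 -> (s - 1) * H0 * (INR m / s) ^ N <= G0 ->
  free_energy m f0 F -> F <= 4 * INR m / INR m ^ N.
Proof.
  intros Hm Hf0 Hs Hs' HG0 Hsub (mu & Hmu & HF).
  pose proof (INR_m_ge2 m Hm) as Hm2.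
  assert (Hlaw := fun n => proj1 (law_mean m f0 Hf0 mu Hmu n)).
  destruct (subcritical_preserved m f0 s G0 H0 N Hm Hlaw ltac:(lra) HG0 Hsub)
    as (G & H & [HG HH] & Hle).
  destruct (Hlaw N) as [Hp0 Hp1].
  pose proof (free_energy_le m f0 Hm Hf0 mu F Hmu HF N) as HFN.
  apply Rle_trans with (1 := HFN).
  unfold Rdiv. apply Rmult_le_compat_r.
  { apply Rlt_le, Rinv_0_lt_compat, pow_lt. lra. }
  assert (HmuH : mu N <= H).
  { pose proof (Hmu N) as HN. apply is_series_Reals in HN.
    apply (series_le _ _ _ _) with (2 := HN) (3 := HH).
    intros k. apply Rmult_le_compat_l; [apply pos_INR|].
    specialize (Hp0 k). pose proof (pow_R1_Rle s k ltac:(lra)). nra. }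
  (* [k s^k >= 2 s^k - m] for every [k] *)
  assert (H2G : 2 * G + - INR m * 1 <= H).
  { apply (series_le _ _ _ _) with (2 := series_linear _ _ 2 (- INR m) _ _ HG Hp1)
      (3 := HH).
    intros [|[|k]]; simpl pow.
    - simpl INR. specialize (Hp0 0%nat). nra.
    - simpl INR. specialize (Hp0 1%nat). nra.
    - specialize (Hp0 (S (S k))).
      assert (2 <= INR (S (S k))) by (apply (le_INR 2); lia).
      assert (0 <= law m f0 N (S (S k)) * (s * (s * s ^ k))).
      { apply Rmult_le_pos; [exact Hp0|]. pose proof (pow_R1_Rle s k ltac:(lra)). nra. }
      nra. }
  assert (Hsm : INR m <= s + 1 / 4) by lra.
  assert (0 <= H).
  { pose proof (series_ge_partial _ _ 0 (fun k => Rmult_le_pos _ _ (pos_INR k)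
      (Rmult_le_pos _ _ (Hp0 k) (pow_le s k ltac:(lra)))) HH) as K. simpl in K. lra. }
  nra.
Qed.

(** * Tail estimates and the truncated system *)

Lemma conv_comm (f g : nat -> R) (n : nat) : conv f g n = conv g f n.
Proof.
  unfold conv. rewrite <- sum_f_R0_skip. apply sum_eq. intros k Hk.
  replace (n - (n - k))%nat with k by lia. ring.
Qed.

Lemma sum_conv (f g : nat -> R) (n : nat) :
  sum_f_R0 (conv f g) n = sum_f_R0 (fun k => f k * sum_f_R0 g (n - k)) n.
Proof.
  induction n as [|n IH]; [reflexivity|].
  rewrite tech5, IH. unfold conv. rewrite 2!tech5, Nat.sub_diag.
  rewrite <- Rplus_assoc, <- sum_plus. f_equal.
  apply sum_eq. intros k Hk.
  rewrite (Nat.sub_succ_l k n Hk). rewrite tech5. ring.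
Qed.

Lemma sum_conv_mono_r (f g g' : nat -> R) (n : nat) :
  (forall k, 0 <= f k) -> (forall k, sum_f_R0 g k <= sum_f_R0 g' k) ->
  sum_f_R0 (conv f g) n <= sum_f_R0 (conv f g') n.
Proof.
  intros Hf Hg. rewrite 2!sum_conv. apply sum_Rle. intros k _.
  apply Rmult_le_compat_l; auto.
Qed.

(** Partial sums are distribution functions, so the hypothesis says that [g] is stochastically
    smaller. The factors are exchanged one at a time, commutativity bringing the exchanged one to
    the right. *)
Lemma sum_conv_pow_mono (f g : nat -> R) (j n : nat) :
  (forall k, 0 <= f k) -> (forall k, 0 <= g k) ->
  (forall k, sum_f_R0 f k <= sum_f_R0 g k) ->
  sum_f_R0 (conv_pow f j) n <= sum_f_R0 (conv_pow g j) n.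
Proof.
  intros Hf Hg Hle. revert n. induction j as [|j IH]; intros n; [simpl; lra|].
  simpl. apply Rle_trans with (sum_f_R0 (conv f (conv_pow g j)) n).
  - now apply sum_conv_mono_r.
  - rewrite (sum_eq (conv f (conv_pow g j)) (conv (conv_pow g j) f))
      by (intros; apply conv_comm).
    rewrite (sum_eq (conv g (conv_pow g j)) (conv (conv_pow g j) g))
      by (intros; apply conv_comm).
    apply sum_conv_mono_r; [now apply conv_pow_ge0|exact Hle].
Qed.

(** A sum of nonnegative variables is at most [n] only if each summand is. *)
Lemma sum_conv_pow_le (f : nat -> R) (j n : nat) :
  (forall k, 0 <= f k) -> sum_f_R0 (conv_pow f j) n <= sum_f_R0 f n ^ j.
Proof.
  intros Hf. revert n. induction j as [|j IH]; intros n.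
  - simpl. rewrite (sum_f_R0_finite _ 0 n); [simpl; lra| |lia].
    intros [|k] Hk; [lia|reflexivity].
  - simpl. rewrite sum_conv.
    apply Rle_trans with (sum_f_R0 (fun k => f k * sum_f_R0 f n ^ j) n).
    + apply sum_Rle. intros k Hk. apply Rmult_le_compat_l; [apply Hf|].
      apply Rle_trans with (1 := IH (n - k)%nat).
      apply pow_incr. split; [now apply cond_pos_sum|].
      assert (H : (n - k <= n)%nat) by lia. clear -Hf H. revert H.
      generalize (n - k)%nat. intros a H.
      induction H as [|i Hi IHi]; [lra|]. simpl. specialize (Hf (S i)). lra.
    + rewrite <- scal_sum. lra.
Qed.

Lemma sum_step (m : nat) (f : nat -> R) (n : nat) :
  sum_f_R0 (step m f) n = sum_f_R0 (conv_pow f m) (S n).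
Proof.
  induction n as [|n IH]; [reflexivity|]. rewrite tech5, IH. reflexivity.
Qed.

(** [X_(n+j)] is at least the maximum of [m^j] independent copies of [X_n], minus [j]: each
    generation subtracts at most 1 along a line of descent. *)
Lemma sum_law_le (m : nat) (f0 : nat -> R) (n j i : nat) :
  (forall n k, 0 <= law m f0 n k) ->
  sum_f_R0 (law m f0 (n + j)) i <= sum_f_R0 (law m f0 n) (i + j) ^ (m ^ j).
Proof.
  intros H0. revert i. induction j as [|j IH]; intros i.
  - rewrite 2!Nat.add_0_r. simpl. lra.
  - rewrite Nat.add_succ_r. simpl law. rewrite sum_step.
    apply Rle_trans with (1 := sum_conv_pow_le _ m (S i) (H0 _)).
    replace (m ^ S j)%nat with (m ^ j * m)%nat by (simpl; lia).
    rewrite pow_mult. apply pow_incr. split; [now apply cond_pos_sum|].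
    replace (i + S j)%nat with (S i + j)%nat by lia. apply IH.
Qed.

(** [(1 - x)(1 + x) <= 1], and Bernoulli gives [(1 + x)^M >= 2]. *)
Lemma pow_one_minus_le_half (x : R) (M : nat) :
  0 <= x <= 1 -> 1 <= INR M * x -> (1 - x) ^ M <= / 2.
Proof.
  intros Hx HM.
  assert (H0 : 0 < x).
  { destruct (Rle_lt_or_eq_dec 0 x (proj1 Hx)) as [|E]; [assumption|].
    rewrite <- E in HM. lra. }
  pose proof (poly M x H0) as HP.
  assert (H1 : (1 - x) ^ M * (1 + x) ^ M <= 1).
  { rewrite <- Rpow_mult_distr.
    apply Rle_trans with (1 ^ M); [apply pow_incr; nra|rewrite pow1; lra]. }
  pose proof (pow_le (1 - x) M ltac:(lra)). nra.
Qed.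

(* If [m ^ j P(X_n >= j + 4) >= 1] then [X_(n+j) >= 4] with probability at least
   1/2, so [E X_(n+j) >= 2] and the free energy is at least [m ^ - (n + j)]. *)
Lemma tail_bound (m : nat) (f0 : nat -> R) (F : R) (n k N : nat) :
  (2 <= m)%nat -> pmf f0 -> free_energy m f0 F -> F < / INR m ^ N ->
  (n + k <= N)%nat ->
  INR m ^ k * (1 - sum_f_R0 (law m f0 n) (k + 3)) <= 1.
Proof.
  intros Hm Hf0 (mu & Hmu & HF) HFN Hnk.
  pose proof (INR_m_ge2 m Hm) as Hm2.
  assert (Hlaw := fun n => proj1 (law_mean m f0 Hf0 mu Hmu n)).
  destruct (Rle_dec (INR m ^ k * (1 - sum_f_R0 (law m f0 n) (k + 3))) 1)
    as [|Hn]; [assumption|exfalso].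
  set (x := 1 - sum_f_R0 (law m f0 n) (k + 3)) in *.
  assert (Hx : 0 <= x <= 1).
  { unfold x. pose proof (pmf_le1 _ (k + 3) (Hlaw n)).
    pose proof (cond_pos_sum _ (k + 3) (proj1 (Hlaw n))). lra. }
  pose proof (pow_one_minus_le_half x (m ^ k) Hx) as Hh.
  rewrite pow_INR in Hh. specialize (Hh ltac:(lra)).
  pose proof (sum_law_le m f0 n k 3 (fun n => proj1 (Hlaw n))) as Hc.
  replace (3 + k)%nat with (k + 3)%nat in Hc by lia.
  replace (1 - x) with (sum_f_R0 (law m f0 n) (k + 3)) in Hh
    by (unfold x; ring).
  pose proof (markov _ _ 3 (Hlaw (n + k)%nat) (Hmu (n + k)%nat)) as HM.
  simpl INR in HM.
  pose proof (free_energy_ge m f0 Hm Hf0 mu F Hmu HF (n + k)) as HG.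
  (* The height 4 is chosen for this: a mean of at least 2 still leaves 1 after the loss of
     [1/(m-1)] in [free_energy_ge]. *)
  assert (Hinv : / (INR m - 1) <= 1).
  { rewrite <- Rinv_1. apply Rinv_le_contravar; lra. }
  assert (Hpos : 0 < INR m ^ (n + k)) by (apply pow_lt; lra).
  assert (/ INR m ^ N <= / INR m ^ (n + k)).
  { apply Rinv_le_contravar; [exact Hpos|]. apply Rle_pow; [lra|exact Hnk]. }
  assert (0 < / INR m ^ (n + k)) by now apply Rinv_0_lt_compat.
  unfold Rdiv in HG. nra.
Qed.

(* The mass above [N] is moved to 0 rather than deleted: each step multiplies a
   defect of total mass by [m], so deletions would not stay negligible. *)
Definition trunc (N : nat) (f : nat -> R) (k : nat) : R :=
  match k with
  | O => f O + (1 - sum_f_R0 f N)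
  | S _ => if Nat.leb k N then f k else 0
  end.

Lemma trunc_ge0 (N : nat) (f : nat -> R) :
  pmf f -> forall k, 0 <= trunc N f k.
Proof.
  intros Hf [|k]; unfold trunc.
  - pose proof (pmf_le1 f N Hf). pose proof (proj1 Hf 0%nat). lra.
  - destruct (Nat.leb (S k) N); [apply Hf|lra].
Qed.

Lemma trunc_support (N : nat) (f : nat -> R) (k : nat) :
  (N < k)%nat -> trunc N f k = 0.
Proof.
  intros Hk. destruct k; [lia|]. unfold trunc.
  destruct (Nat.leb_spec (S k) N); [lia|reflexivity].
Qed.

Lemma sum_trunc_le (N : nat) (f : nat -> R) (n : nat) :
  (n <= N)%nat -> sum_f_R0 (trunc N f) n = sum_f_R0 f n + (1 - sum_f_R0 f N).
Proof.
  induction n as [|n IH]; intros Hn; [reflexivity|].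
  rewrite 2!tech5, IH by lia. unfold trunc at 1.
  destruct (Nat.leb_spec (S n) N); [ring|lia].
Qed.

Lemma pmf_trunc (N : nat) (f : nat -> R) : pmf f -> pmf (trunc N f).
Proof.
  intros Hf. split; [now apply trunc_ge0|].
  eapply series_ext; [reflexivity| |apply (series_finite _ N)].
  - rewrite sum_trunc_le by lia. ring.
  - apply trunc_support.
Qed.

Lemma sum_trunc_ge (N : nat) (f g : nat -> R) (n : nat) :
  pmf f -> pmf g -> (forall n, sum_f_R0 f n <= sum_f_R0 g n) ->
  sum_f_R0 f n <= sum_f_R0 (trunc N g) n.
Proof.
  intros Hf Hg Hle. destruct (Nat.le_gt_cases n N) as [Hn|Hn].
  - rewrite sum_trunc_le by exact Hn.
    pose proof (pmf_le1 g N Hg). specialize (Hle n). lra.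
  - rewrite (sum_f_R0_finite _ N n (trunc_support N g)) by lia.
    rewrite sum_trunc_le by lia. pose proof (pmf_le1 f n Hf). lra.
Qed.

Lemma conv_support (f g : nat -> R) (A B : nat) :
  (forall k, (A < k)%nat -> f k = 0) -> (forall k, (B < k)%nat -> g k = 0) ->
  forall k, (A + B < k)%nat -> conv f g k = 0.
Proof.
  intros Hf Hg k Hk. unfold conv. rewrite (sum_eq _ (fun _ => 0)).
  - rewrite sum_cte. ring.
  - intros i Hi. destruct (Nat.le_gt_cases i A).
    + rewrite (Hg (k - i)%nat) by lia. ring.
    + rewrite (Hf i) by lia. ring.
Qed.

Lemma step_support (m : nat) (f : nat -> R) (N : nat) :
  (forall k, (N < k)%nat -> f k = 0) ->
  forall k, (m * N < k)%nat -> step m f k = 0.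
Proof.
  intros Hf.
  assert (H : forall j k, (j * N < k)%nat -> conv_pow f j k = 0).
  { induction j as [|j IH]; intros k Hk; simpl.
    - destruct k; [lia|reflexivity].
    - apply (conv_support f _ N (j * N) Hf IH). simpl in Hk. lia. }
  intros [|k] Hk; [lia|]. unfold step. apply H. lia.
Qed.

Fixpoint trunc_law (m N : nat) (f0 : nat -> R) (n : nat) : nat -> R :=
  match n with
  | O => trunc N f0
  | S n' => trunc N (step m (trunc_law m N f0 n'))
  end.

Lemma finite_gf (f : nat -> R) (s : R) (N : nat) :
  (forall k, (N < k)%nat -> f k = 0) -> exists G H, gf f s G H.
Proof.
  intros Hf. eexists _, _. split; apply (series_finite _ N);
    intros k Hk; rewrite (Hf k Hk); ring.
Qed.

Lemma finite_pmf_step (m : nat) (f : nat -> R) (N : nat) :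
  pmf f -> (forall k, (N < k)%nat -> f k = 0) -> pmf (step m f).
Proof.
  intros Hf HN. destruct (finite_gf f 1 N HN) as (G & H & HG).
  assert (G = 1).
  { apply (series_unique _ _ _ (proj1 HG)).
    eapply series_ext; [|reflexivity|exact (proj2 Hf)].
    intros k; simpl. rewrite pow1. ring. }
  subst G. destruct (gf_1_pmf f H (proj1 Hf) HG) as [_ Hm].
  exact (proj1 (mean_step m f H Hf Hm)).
Qed.

Lemma trunc_law_pmf (m N : nat) (f0 : nat -> R) (n : nat) :
  pmf f0 -> pmf (trunc_law m N f0 n) /\
  (forall k, (N < k)%nat -> trunc_law m N f0 n k = 0).
Proof.
  intros Hf0. induction n as [|n [IH1 IH2]]; simpl.
  - split; [now apply pmf_trunc|apply trunc_support].
  - split; [apply pmf_trunc, (finite_pmf_step m _ N IH1 IH2)|apply trunc_support].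
Qed.

(** The truncated system stays stochastically below the true one. The second half concerns the law
    just before truncation, whose mass above [N] has to be bounded by the true tail. *)
Lemma sum_law_trunc (m N : nat) (f0 : nat -> R) (n k : nat) :
  pmf f0 -> (forall n, pmf (law m f0 n)) ->
  sum_f_R0 (law m f0 n) k <= sum_f_R0 (trunc_law m N f0 n) k /\
  sum_f_R0 (law m f0 (S n)) k <= sum_f_R0 (step m (trunc_law m N f0 n)) k.
Proof.
  intros Hf0 Hlaw. revert k.
  assert (S1 : forall n, (forall k, sum_f_R0 (law m f0 n) k <=
      sum_f_R0 (trunc_law m N f0 n) k) ->
    forall k, sum_f_R0 (law m f0 (S n)) k <= sum_f_R0 (step m (trunc_law m N f0 n)) k).
  { intros i Hi k. simpl law. rewrite 2!sum_step.
    apply sum_conv_pow_mono; [apply Hlaw|apply trunc_law_pmf, Hf0|exact Hi]. }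
  induction n as [|n IH]; intros k.
  - assert (H : forall k, sum_f_R0 (law m f0 0) k <= sum_f_R0 (trunc_law m N f0 0) k).
    { intros i. simpl. apply sum_trunc_ge; auto using Rle_refl. }
    split; [apply H|now apply S1].
  - destruct (trunc_law_pmf m N f0 n Hf0) as [Hp Hs].
    assert (H : forall k, sum_f_R0 (law m f0 (S n)) k <=
      sum_f_R0 (trunc_law m N f0 (S n)) k).
    { intros i. simpl trunc_law. apply sum_trunc_ge; [apply Hlaw| |apply IH].
      exact (finite_pmf_step m _ N Hp Hs). }
    split; [apply H|now apply S1].
Qed.

Lemma pmf_term_le_tail (f g : nat -> R) (k : nat) :
  pmf g -> (forall n, sum_f_R0 f n <= sum_f_R0 g n) ->
  g (S k) <= 1 - sum_f_R0 f k.
Proof.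
  intros Hg Hle. pose proof (pmf_le1 g (S k) Hg) as H.
  rewrite tech5 in H. specialize (Hle k). lra.
Qed.

(** * Growth of the drift *)

Lemma series_finite_le (a : nat -> R) (l c : R) (K : nat) :
  (forall k, (k <= K)%nat -> a k <= c) -> (forall k, (K < k)%nat -> a k = 0) ->
  is_series a l -> l <= c * INR (S K).
Proof.
  intros Hc H0 Ha. rewrite (series_unique _ _ _ Ha (series_finite a K H0)).
  rewrite <- sum_cte. now apply sum_Rle.
Qed.

(** The removed part [t] lowers [H] by at most [c (K + 1)]. It also lowers [G] by its weight at [s],
    which exceeds the mass [eta] put back at 0, so the change in [G] can only help. *)
Lemma trunc_drift (N K : nat) (f : nat -> R) (s c G H : R) :
  pmf f -> 1 <= s -> gf f s G H -> 0 <= c ->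
  (forall k, (K < k)%nat -> f k = 0) ->
  (forall k, (N < k)%nat -> (k <= K)%nat -> INR k * (f k * s ^ k) <= c) ->
  exists G' H', gf (trunc N f) s G' H' /\
    (s - 1) * H - G - (s - 1) * (c * INR (S K)) <= (s - 1) * H' - G'.
Proof.
  intros Hf Hs HG Hc HK Hb.
  set (t := fun k => if Nat.leb k N then 0 else f k).
  assert (HtK : forall k, (K < k)%nat -> t k = 0).
  { intros k Hk. unfold t. destruct (Nat.leb k N); auto. }
  assert (Ht0 : forall k, 0 <= t k).
  { intros k. unfold t. destruct (Nat.leb k N); [lra|apply Hf]. }
  set (eta := 1 - sum_f_R0 f N).
  assert (E : forall k, 1 * (1 * f k + -1 * t k) + eta * dirac0 k = trunc N f k).
  { intros [|k]; unfold t, trunc, eta, dirac0; [simpl; ring|].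
    destruct (Nat.leb (S k) N); ring. }
  (* Stated for every base [r]: at [r = 1] it identifies the mass of [t] with [eta], at [r = s] it
     gives the result. *)
  assert (L : forall r g h gt ht, gf f r g h -> gf t r gt ht ->
    gf (trunc N f) r (g - gt + eta) (h - ht)).
  { intros r g h gt ht Hg Ht.
    refine (gf_ext _ _ _ _ _ _ _ E _ _
      (gf_linear _ _ _ _ _ _ _ _ _ (gf_linear _ _ _ 1 (-1) _ _ _ _ Hg Ht)
         (gf_dirac0 r))); ring. }
  destruct (finite_gf t s K HtK) as (Gt & Ht & HGt).
  destruct (finite_gf t 1 K HtK) as (Mt & M1 & HMt).
  destruct (finite_gf f 1 K HK) as (Mf & M2 & HMf).
  assert (Heta : Mt = eta).
  { pose proof (L _ _ _ _ _ HMf HMt) as [L1 _].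
    assert (Mf = 1).
    { apply (series_unique _ _ _ (proj1 HMf)).
      eapply series_ext; [|reflexivity|exact (proj2 Hf)].
      intros k; simpl. rewrite pow1. ring. }
    assert (Mf - Mt + eta = 1).
    { apply (series_unique _ _ _ L1).
      eapply series_ext; [|reflexivity|exact (proj2 (pmf_trunc N f Hf))].
      intros k; simpl. rewrite pow1. ring. }
    lra. }
  assert (HetaG : eta <= Gt).
  { rewrite <- Heta. apply (series_le _ _ _ _) with (2 := proj1 HMt) (3 := proj1 HGt).
    intros k. rewrite pow1. apply Rmult_le_compat_l; [apply Ht0|].
    now apply pow_R1_Rle. }
  assert (HHt : Ht <= c * INR (S K)).
  { apply (series_finite_le _ _ _ _) with (3 := proj2 HGt).
    - intros k Hk. unfold t. destruct (Nat.leb_spec k N); [|auto].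
      replace (INR k * (0 * s ^ k)) with 0 by ring. exact Hc.
    - intros k Hk. rewrite (HtK k Hk). ring. }
  exists (G - Gt + eta), (H - Ht). split; [now apply L|].
  assert ((s - 1) * Ht <= (s - 1) * (c * INR (S K)))
    by (apply Rmult_le_compat_l; lra).
  lra.
Qed.

(* [k s^k <= 3 N (s^k - 1)] for [k <= N] converts the lower bound on [H] given by
   the drift into one on [G - 1]. *)
Lemma gf_gain (f : nat -> R) (s G H : R) (N : nat) :
  pmf f -> (1 <= N)%nat -> (forall k, (N < k)%nat -> f k = 0) ->
  3 / 2 <= s -> gf f s G H -> 0 <= (s - 1) * H - G ->
  1 + / (3 * (s - 1) * INR N) <= G.
Proof.
  intros Hf HN Hsup Hs HG Hd.
  assert (H1G := gf_ge_mass f s G H Hf ltac:(lra) HG).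
  destruct HG as [HG HH].
  assert (HN1 : 1 <= INR N) by (apply (le_INR 1) in HN; exact HN).
  assert (HN0 : 0 < / (3 * INR N)) by (apply Rinv_0_lt_compat; lra).
  assert (Hle : / (3 * INR N) * H + 0 * H <= 1 * G + -1 * 1).
  { apply (series_le _ _ _ _) with
      (2 := series_linear _ _ (/ (3 * INR N)) 0 _ _ HH HH)
      (3 := series_linear _ _ 1 (-1) _ _ HG (proj2 Hf)).
    intros [|k]; [simpl; lra|].
    destruct (Nat.le_gt_cases (S k) N) as [Hk|Hk].
    - pose proof (proj1 Hf (S k)) as Hfk.
      apply le_INR in Hk.
      pose proof (pow_R1_Rle s k ltac:(lra)) as Hsk.
      (* Equivalent to [s ^ S k >= 3/2], the reason for the lower bound assumed on [s]. *)
      assert (Hs1 : s ^ S k <= 3 * (s ^ S k - 1)) by (simpl; nra).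
      assert (Hkn : / (3 * INR N) * INR (S k) <= / 3).
      { apply Rmult_le_reg_r with (3 * INR N); [lra|].
        replace (/ (3 * INR N) * INR (S k) * (3 * INR N)) with (INR (S k))
          by (field; lra). lra. }
      assert (0 <= f (S k) * s ^ S k) by (apply Rmult_le_pos; [exact Hfk|apply pow_le; lra]).
      apply Rle_trans with (/ 3 * (f (S k) * s ^ S k)).
      + rewrite Rmult_0_l, Rplus_0_r, <- Rmult_assoc.
        now apply Rmult_le_compat_r.
      + nra.
    - rewrite (Hsup _ Hk). lra. }
  assert (HH1 : / (s - 1) <= H).
  { apply Rmult_le_reg_l with (s - 1); [lra|]. rewrite Rinv_r by lra. lra. }
  replace (/ (3 * (s - 1) * INR N)) with (/ (3 * INR N) * / (s - 1))
    by (field; lra).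
  assert (/ (3 * INR N) * / (s - 1) <= / (3 * INR N) * H)
    by (apply Rmult_le_compat_l; lra).
  lra.
Qed.

(** With [rho = 1 / (6 (m - 1) N)], [gf_gain] yields [G >= 1 + 2 rho]. One [rho] pays for the
    truncation, whose cost is at most [e0 rho] and so at most [rho] times the current drift; the
    other [rho] is net growth. *)
Lemma trunc_growth (m N : nat) (f0 : nat -> R) (s e0 c G0 H0 : R) (T : nat) :
  (2 <= m)%nat -> (1 <= N)%nat -> pmf f0 -> 3 / 2 <= s <= INR m ->
  0 <= c -> 0 < e0 ->
  (forall n k, (n < T)%nat -> (N < k)%nat -> (k <= m * N)%nat ->
     INR k * (step m (trunc_law m N f0 n) k * s ^ k) <= c) ->
  (INR m - 1) * (c * INR (S (m * N))) <= e0 * / (6 * (INR m - 1) * INR N) ->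
  gf (trunc N f0) s G0 H0 -> e0 <= (s - 1) * H0 - G0 ->
  exists G H, gf (trunc_law m N f0 T) s G H /\
    e0 * (1 + / (6 * (INR m - 1) * INR N)) ^ T <= (s - 1) * H - G.
Proof.
  intros Hm HN Hf0 Hs Hc He0 Hb Hloss HG0 Hinit.
  pose proof (INR_m_ge2 m Hm) as Hm2.
  assert (HN1 : 1 <= INR N) by (apply (le_INR 1) in HN; exact HN).
  set (rho := / (6 * (INR m - 1) * INR N)) in *.
  assert (Hrho : 0 < rho) by (apply Rinv_0_lt_compat; nra).
  induction T as [|T IH].
  - exists G0, H0. split; [exact HG0|simpl; lra].
  - destruct IH as (G & H & HG & Hd); [intros n k Hn; apply Hb; lia|].
    destruct (trunc_law_pmf m N f0 T Hf0) as [Hp Hsup].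
    assert (Hd1 : e0 <= (s - 1) * H - G).
    { apply Rle_trans with (2 := Hd).
      pose proof (pow_R1_Rle (1 + rho) T ltac:(lra)). nra. }
    assert (HGg := gf_gain _ s G H N Hp HN Hsup ltac:(lra) HG ltac:(lra)).
    assert (HG2 : 1 + 2 * rho <= G).
    { apply Rle_trans with (2 := HGg).
      replace (2 * rho) with (/ (3 * (INR m - 1) * INR N)) by (unfold rho; field; lra).
      apply Rplus_le_compat_l, Rinv_le_contravar; [nra|].
      apply Rmult_le_compat_r; lra. }
    pose proof (gf_step m _ s G H (proj1 Hp) ltac:(lra) HG) as HG'.
    pose proof (drift_step m s G H (trunc_law m N f0 T 0%nat ^ m) Hm ltac:(lra)) as HD.
    destruct (trunc_drift N (m * N) _ s c _ _ (finite_pmf_step m _ N Hp Hsup)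
      ltac:(lra) HG' Hc (step_support m _ N Hsup)
      (fun k => Hb T k (Nat.lt_succ_diag_r T))) as (G1 & H1 & HG1 & Hd').
    exists G1, H1. split; [exact HG1|].
    rewrite HD in Hd'.
    set (D := (s - 1) * H - G) in *.
    assert (Hgain : (1 + 2 * rho) * D <= G ^ pred m * (INR m / s * ((s - 1) * H) - G)).
    { assert (Hr : 1 <= INR m / s).
      { apply Rmult_le_reg_r with s; [lra|].
        unfold Rdiv. rewrite Rmult_assoc, Rinv_l by lra. lra. }
      assert (D <= INR m / s * ((s - 1) * H) - G).
      { unfold D. assert (0 <= (s - 1) * H) by (unfold D in *; lra). nra. }
      assert (G <= G ^ pred m).
      { destruct m as [|[|m']]; [lia|lia|]. simpl.
        pose proof (pow_R1_Rle G m' ltac:(lra)). nra. }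
      apply Rmult_le_compat; lra. }
    assert ((s - 1) * (c * INR (S (m * N))) <= e0 * rho).
    { apply Rle_trans with (2 := Hloss). apply Rmult_le_compat_r; [|lra].
      apply Rmult_le_pos; [exact Hc|apply pos_INR]. }
    assert (e0 * rho <= D * rho) by (apply Rmult_le_compat_r; lra).
    simpl. nra.
Qed.

(* If [F < m^(-(T + m N))], then [P (X_n = k) <= m^(4-k)] up to time [T] and height
   [m N], which caps the drift of the truncated system. *)
Lemma free_energy_lower (m N : nat) (f0 : nat -> R) (x e0 G0 H0 F : R) (T : nat) :
  (2 <= m)%nat -> (1 <= N)%nat -> pmf f0 -> 3 / 4 <= x <= 1 -> 0 < e0 ->
  (INR m - 1) * (INR (m * N) * INR m ^ 4 * x ^ N * INR (S (m * N)))
    <= e0 * / (6 * (INR m - 1) * INR N) ->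
  gf (trunc N f0) (INR m * x) G0 H0 -> e0 <= (INR m * x - 1) * H0 - G0 ->
  (INR m - 1) * (INR N * INR m ^ 4 * INR (S N))
    < e0 * (1 + / (6 * (INR m - 1) * INR N)) ^ T ->
  free_energy m f0 F -> / INR m ^ (T + m * N) <= F.
Proof.
  intros Hm HN Hf0 Hx He0 Hloss HG0 Hinit Hbig HF.
  destruct (Rle_lt_dec (/ INR m ^ (T + m * N)) F) as [|HFN]; [assumption|exfalso].
  pose proof (INR_m_ge2 m Hm) as Hm2.
  assert (Hlaw : forall n, pmf (law m f0 n)).
  { destruct HF as (mu & Hmu & _). intros n. apply (law_mean m f0 Hf0 mu Hmu). }
  set (s := INR m * x) in *.
  assert (Hs : 3 / 2 <= s <= INR m) by (unfold s; nra).
  assert (B : forall g n k, (n + k <= T + m * N)%nat -> pmf g ->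
    (forall i, sum_f_R0 (law m f0 n) i <= sum_f_R0 g i) ->
    g k * s ^ k <= INR m ^ 4 * x ^ k).
  { intros g n k Hnk Hg Hle.
    assert (Hgk : g k * INR m ^ k <= INR m ^ 4).
    { destruct (Nat.le_gt_cases 4 k) as [Hk|Hk].
      (* Here [k - 4 + 3] is [k - 1], so [tail_bound] at [k - 4] controls [P(X_n >= k)]; the gap of
         4 becomes the factor [m^4]. *)
      - replace k with (S (k - 4 + 3)) at 1 by lia.
        replace k with (4 + (k - 4))%nat at 2 by lia.
        rewrite pow_add.
        assert (E1 := pmf_term_le_tail (law m f0 n) g (k - 4 + 3) Hg Hle).
        assert (E2 := tail_bound m f0 F n (k - 4) _ Hm Hf0 HF HFN ltac:(lia)).
        assert (0 < INR m ^ (k - 4)) by (apply pow_lt; lra).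
        assert (0 < INR m ^ 4) by (apply pow_lt; lra).
        assert (g (S (k - 4 + 3)) * INR m ^ (k - 4) <= 1) by nra.
        nra.
      - pose proof (pmf_term_le1 g k Hg) as H1. pose proof (proj1 Hg k) as H2.
        assert (INR m ^ k <= INR m ^ 4) by (apply Rle_pow; [lra|lia]).
        assert (0 < INR m ^ k) by (apply pow_lt; lra). nra. }
    unfold s. rewrite Rpow_mult_distr, <- Rmult_assoc.
    apply Rmult_le_compat_r; [apply pow_le; lra|exact Hgk]. }
  assert (Hm4 : 0 < INR m ^ 4) by (apply pow_lt; lra).
  (* For [N < k <= m N] the removed weights are at most [m N] times [m^4 x^N]; the factor [x^N]
     makes the loss affordable. *)
  destruct (trunc_growth m N f0 s e0 (INR (m * N) * INR m ^ 4 * x ^ N) G0 H0 T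
    Hm HN Hf0 Hs) as (G & H & HG & Hd); try assumption.
  - apply Rmult_le_pos; [|apply pow_le; lra].
    apply Rmult_le_pos; [apply pos_INR|lra].
  - intros n k Hn HNk Hk.
    destruct (trunc_law_pmf m N f0 n Hf0) as [Hp Hsup].
    assert (Hb : step m (trunc_law m N f0 n) k * s ^ k <= INR m ^ 4 * x ^ k).
    { apply (B _ (S n)); [lia|exact (finite_pmf_step m _ N Hp Hsup)|].
      intros i. now apply sum_law_trunc. }
    assert (Hxk : x ^ k <= x ^ N).
    { replace k with (N + (k - N))%nat by lia. rewrite pow_add.
      assert (x ^ (k - N) <= 1).
      { apply Rle_trans with (1 ^ (k - N)); [apply pow_incr; lra|rewrite pow1; lra]. }
      pose proof (pow_le x N ltac:(lra)). nra. }
    rewrite Rmult_assoc. apply Rmult_le_compat.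
    + apply pos_INR.
    + apply Rmult_le_pos; [apply step_ge0, Hp|apply pow_le; lra].
    + apply le_INR, Hk.
    + apply Rle_trans with (1 := Hb). apply Rmult_le_compat_l; lra.
  - destruct (trunc_law_pmf m N f0 T Hf0) as [Hp Hsup].
    (* At time [T] the same estimate without the gain from [x] bounds [H], and so the drift, by a
       polynomial in [N], contradicting the exponential growth. *)
    assert (HHb : H <= INR N * INR m ^ 4 * INR (S N)).
    { apply (series_finite_le _ _ _ _) with (3 := proj2 HG).
      - intros k Hk. apply Rmult_le_compat.
        + apply pos_INR.
        + apply Rmult_le_pos; [apply Hp|apply pow_le; lra].
        + apply le_INR, Hk.
        + apply Rle_trans with (INR m ^ 4 * x ^ k).
          * assert (k <= m * N)%nat by nia.
            apply (B _ T); [lia|exact Hp|].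
            intros i. now apply sum_law_trunc.
          * assert (x ^ k <= 1).
            { apply Rle_trans with (1 ^ k); [apply pow_incr; lra|rewrite pow1; lra]. }
            nra.
      - intros k Hk. rewrite (Hsup k Hk). ring. }
    assert (H1G := gf_ge_mass _ s G H Hp ltac:(lra) HG).
    assert (0 <= INR N * INR m ^ 4 * INR (S N)).
    { apply Rmult_le_pos; [apply Rmult_le_pos; [apply pos_INR|lra]|apply pos_INR]. }
    assert ((s - 1) * H <= (INR m - 1) * (INR N * INR m ^ 4 * INR (S N))).
    { apply Rle_trans with ((s - 1) * (INR N * INR m ^ 4 * INR (S N))).
      - apply Rmult_le_compat_l; lra.
      - apply Rmult_le_compat_r; lra. }
    lra.
Qed.

(** * Asymptotics of the initial law *)

Lemma ln_succ_bounds (k : nat) :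
  (1 <= k)%nat -> / INR (S k) <= ln (INR (S k)) - ln (INR k) <= / INR k.
Proof.
  intros Hk. apply (le_INR 1) in Hk. change (INR 1) with 1 in Hk.
  rewrite S_INR. set (y := INR k) in *. split.
  - pose proof (exp_ineq1_le (ln y - ln (y + 1))) as H.
    unfold Rminus in H. rewrite exp_plus, exp_Ropp, 2!exp_ln in H by lra.
    assert (y * / (y + 1) = 1 - / (y + 1)) by (field; lra). lra.
  - pose proof (exp_ineq1_le (ln (y + 1) - ln y)) as H.
    unfold Rminus in H. rewrite exp_plus, exp_Ropp, 2!exp_ln in H by lra.
    assert ((y + 1) * / y = 1 + / y) by (field; lra). lra.
Qed.

Lemma pow_one_minus_ge (y : R) (n : nat) :
  0 <= y <= 1 -> 1 - INR n * y <= (1 - y) ^ n.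
Proof.
  intros Hy. induction n as [|n IH]; [simpl; lra|].
  rewrite S_INR. simpl.
  assert (0 <= INR n * y) by (apply Rmult_le_pos; [apply pos_INR|lra]). nra.
Qed.

Lemma geom_sum_le (x : R) (n : nat) :
  0 <= x < 1 -> sum_f_R0 (fun k => x ^ k) n <= / (1 - x).
Proof.
  intros Hx. apply series_ge_partial.
  - intros k. apply pow_le. lra.
  - apply is_series_geom. rewrite Rabs_pos_eq; lra.
Qed.

(** The ratio [s / m = 1 - 1/L] at the dyadic scale [L = 2^l]. Restricting [L] to powers of 2 costs
    a factor at most 2. *)
Definition shrink (l : nat) : R := 1 - / 2 ^ l.

Lemma shrink_bounds (a l : nat) : (a <= l)%nat -> 1 - / 2 ^ a <= shrink l < 1.
Proof.
  intros Ha. unfold shrink.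
  assert (0 < 2 ^ a) by (apply pow_lt; lra).
  assert (0 < / 2 ^ l) by (apply Rinv_0_lt_compat, pow_lt; lra).
  assert (/ 2 ^ l <= / 2 ^ a); [|lra].
  apply Rinv_le_contravar; [assumption|]. apply Rle_pow; [lra|exact Ha].
Qed.

Lemma INR_pow2 (l : nat) : INR (2 ^ l) = 2 ^ l.
Proof. rewrite pow_INR. reflexivity. Qed.

Lemma inv_pow2_le1 (l : nat) : 0 <= / 2 ^ l <= 1.
Proof.
  split; [apply Rlt_le, Rinv_0_lt_compat, pow_lt; lra|].
  rewrite <- Rinv_1. apply Rinv_le_contravar; [lra|]. apply pow_R1_Rle. lra.
Qed.

(** Bernoulli's [(1 - 1/L)^k >= 1 - k/L] for [k <= L / 2^a]. It serves both to keep the terms of [H]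
    below [L / 2^a] nearly undamped and to control [(m / s)^k] over that many steps. *)
Lemma shrink_pow_ge (a l k : nat) :
  (k <= 2 ^ (l - a))%nat -> (a <= l)%nat -> 1 - / 2 ^ a <= shrink l ^ k.
Proof.
  intros Hk Ha. unfold shrink.
  apply Rle_trans with (2 := pow_one_minus_ge (/ 2 ^ l) k (inv_pow2_le1 l)).
  apply le_INR in Hk. rewrite INR_pow2 in Hk.
  replace l with ((l - a) + a)%nat at 1 by lia. rewrite pow_add.
  assert (0 < 2 ^ (l - a)) by (apply pow_lt; lra).
  assert (0 < 2 ^ a) by (apply pow_lt; lra).
  rewrite Rinv_mult.
  assert (INR k * (/ 2 ^ (l - a) * / 2 ^ a) <= / 2 ^ a); [|lra].
  rewrite <- Rmult_assoc.
  assert (INR k * / 2 ^ (l - a) <= 1).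
  { apply Rmult_le_reg_r with (2 ^ (l - a)); [assumption|].
    rewrite Rmult_assoc, Rinv_l by lra. lra. }
  pose proof (inv_pow2_le1 a). nra.
Qed.

Lemma ln_pow2 (l : nat) : ln (INR (2 ^ l)) = INR l * ln 2.
Proof. rewrite INR_pow2, ln_pow by lra. reflexivity. Qed.

Lemma pow2_large (e : R) : 0 < e -> exists a, / 2 ^ a <= e.
Proof.
  intros He. destruct (INR_unbounded (/ e)) as [a Ha]. exists a.
  assert (0 < / e) by now apply Rinv_0_lt_compat.
  rewrite <- (Rinv_inv e). apply Rinv_le_contravar; [assumption|].
  pose proof (poly a 1 Rlt_0_1) as HP. replace (1 + 1) with 2 in HP by ring. lra.
Qed.

Section Tail.
Variables (m : nat) (q : nat -> R) (c0 : R).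
Hypothesis (Hm : (2 <= m)%nat) (Hq0 : forall k, 0 <= q k) (Hq00 : q 0%nat = 0)
  (Hq1 : infinite_sum q 1) (Hc0 : 0 < c0)
  (Hqcv : Un_cv (fun k => q k / (c0 * / (INR m ^ k) * / (INR k ^ 2))) 1).

Lemma pmf_q : pmf q.
Proof. split; [exact Hq0|apply is_series_Reals, Hq1]. Qed.

Lemma weight_ge0 (s : R) (k : nat) : 0 <= s -> 0 <= INR k * (q k * s ^ k).
Proof.
  intros Hs. apply Rmult_le_pos; [apply pos_INR|].
  apply Rmult_le_pos; [apply Hq0|now apply pow_le].
Qed.

Lemma weight_asymp (eta : R) :
  0 < eta -> exists k0, (1 <= k0)%nat /\ forall k, (k0 <= k)%nat ->
    (1 - eta) * c0 * / INR k <= INR k * (q k * INR m ^ k) <= (1 + eta) * c0 * / INR k.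
Proof.
  intros Heta. pose proof (INR_m_ge2 m Hm) as Hm2.
  destruct (Hqcv eta Heta) as [k1 Hk1]. exists (S k1). split; [lia|].
  intros k Hk. specialize (Hk1 k ltac:(lia)). unfold Rdist in Hk1.
  assert (HK : 1 <= INR k) by (apply (le_INR 1); lia).
  assert (HM : 0 < INR m ^ k) by (apply pow_lt; lra).
  set (y := q k / (c0 * / INR m ^ k * / INR k ^ 2)) in *.
  assert (E : INR k * (q k * INR m ^ k) = y * c0 * / INR k).
  { unfold y. field. repeat split; lra. }
  rewrite E. apply Rabs_def2 in Hk1.
  assert (0 < / INR k) by (apply Rinv_0_lt_compat; lra).
  split; (apply Rmult_le_compat_r; [lra|]); apply Rmult_le_compat_r; lra.
Qed.

Lemma weight_bounded :
  exists B, 0 < B /\ forall k, INR k * (INR k * (q k * INR m ^ k)) <= B.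
Proof.
  pose proof (INR_m_ge2 m Hm) as Hm2.
  destruct (weight_asymp 1 Rlt_0_1) as (k0 & Hk0 & H).
  assert (HB0 : 0 <= INR k0 * (INR k0 * INR m ^ k0)).
  { apply Rmult_le_pos; [apply pos_INR|].
    apply Rmult_le_pos; [apply pos_INR|apply pow_le; lra]. }
  exists (2 * c0 + INR k0 * (INR k0 * INR m ^ k0)). split; [lra|].
  intros k. destruct (Nat.le_gt_cases k0 k) as [Hk|Hk].
  - assert (1 <= INR k) by (apply (le_INR 1); lia).
    apply Rle_trans with (INR k * ((1 + 1) * c0 * / INR k)).
    + apply Rmult_le_compat_l; [lra|]. now apply H.
    + replace (INR k * ((1 + 1) * c0 * / INR k)) with (2 * c0) by (field; lra). lra.
  - assert (INR k <= INR k0) by (apply le_INR; lia).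
    assert (INR m ^ k <= INR m ^ k0) by (apply Rle_pow; [lra|lia]).
    pose proof (pmf_term_le1 q k pmf_q). pose proof (Hq0 k).
    assert (0 < INR m ^ k) by (apply pow_lt; lra).
    assert (q k * INR m ^ k <= INR m ^ k0) by nra.
    pose proof (pos_INR k).
    assert (0 <= q k * INR m ^ k) by nra.
    assert (INR k * (INR k * (q k * INR m ^ k)) <= INR k0 * (INR k0 * INR m ^ k0)).
    { apply Rmult_le_compat; [lra|nra|lra|]. apply Rmult_le_compat; lra. }
    lra.
Qed.

(** The terms are [O(1/k^2)], summed through the telescoping bound [1/k^2 <= 1/(k-1) - 1/k]. Thus
    [G] contributes only [O(p)] beyond 1 to the drift of the mixture, uniformly in the scale. *)
Lemma mass_sum_bounded :
  exists Q, 0 < Q /\ forall n, sum_f_R0 (fun k => q k * INR m ^ k) n <= Q.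
Proof.
  destruct weight_bounded as (B & HB & H). exists (2 * B). split; [lra|].
  assert (K : forall n, sum_f_R0 (fun k => q k * INR m ^ k) (S n) <= B * (2 - / INR (S n))).
  { induction n as [|n IH].
    - simpl. rewrite Hq00. specialize (H 1%nat). simpl in H. lra.
    - rewrite tech5. specialize (H (S (S n))).
      set (z := q (S (S n)) * INR m ^ S (S n)) in *.
      rewrite (S_INR (S n)) in *.
      assert (Hy : 1 <= INR (S n)) by (apply (le_INR 1); lia).
      set (y := INR (S n)) in *.
      assert (Hz : z <= B * (/ y - / (y + 1))).
      { apply Rle_trans with (B * / (y + 1) * / (y + 1)).
        - apply Rmult_le_reg_l with ((y + 1) * (y + 1)); [nra|].
          replace ((y + 1) * (y + 1) * (B * / (y + 1) * / (y + 1))) with B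
            by (field; lra). nra.
        - replace (/ y - / (y + 1)) with (/ (y + 1) * / y) by (field; lra).
          rewrite Rmult_assoc. apply Rmult_le_compat_l; [lra|].
          apply Rmult_le_compat_l; [apply Rlt_le, Rinv_0_lt_compat; lra|].
          apply Rinv_le_contravar; lra. }
      lra. }
  intros [|n].
  - simpl. rewrite Hq00. lra.
  - apply Rle_trans with (1 := K n).
    assert (0 < / INR (S n)) by (apply Rinv_0_lt_compat, (lt_INR 0); lia). nra.
Qed.

Lemma gf_q (s : R) : 0 <= s < INR m -> exists G H, gf q s G H.
Proof.
  intros Hs. pose proof (INR_m_ge2 m Hm) as Hm2.
  destruct weight_bounded as (B & HB & HW).
  set (x := s / INR m).
  assert (Hx : 0 <= x < 1).
  { unfold x. split; [apply Rdiv_le_0_compat; lra|].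
    apply Rmult_lt_reg_r with (INR m); [lra|].
    unfold Rdiv. rewrite Rmult_assoc, Rinv_l by lra. lra. }
  assert (Es : forall k, s ^ k = INR m ^ k * x ^ k).
  { intros k. rewrite <- Rpow_mult_distr. f_equal. unfold x. field. lra. }
  (* The vacuous second summand only lets [series_linear] act as scaling. *)
  assert (Hgeo : is_series (fun k => B * x ^ k + 0 * x ^ k) (B * / (1 - x) + 0 * / (1 - x))).
  { assert (Hg : is_series (fun k => x ^ k) (/ (1 - x)))
      by (apply is_series_geom; rewrite Rabs_pos_eq; lra).
    exact (series_linear _ _ B 0 _ _ Hg Hg). }
  assert (HH : forall k, INR k * (q k * s ^ k) <= B * x ^ k + 0 * x ^ k).
  { intros k. rewrite Es. pose proof (pow_le x k (proj1 Hx)) as Hxk.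
    replace (INR k * (q k * (INR m ^ k * x ^ k))) with
      ((INR k * (q k * INR m ^ k)) * x ^ k) by ring.
    replace (B * x ^ k + 0 * x ^ k) with (B * x ^ k) by ring.
    apply Rmult_le_compat_r; [exact Hxk|].
    destruct k as [|k]; [simpl; lra|].
    pose proof (HW (S k)) as HWk.
    pose proof (weight_ge0 (INR m) (S k) ltac:(lra)).
    assert (1 <= INR (S k)) by (apply (le_INR 1); lia). nra. }
  destruct (series_ge0_ex_le (fun k => INR k * (q k * s ^ k)) _ _
    (fun k => conj (weight_ge0 s k (proj1 Hs)) (HH k)) Hgeo) as [H HsH].
  destruct (series_ge0_ex_le (fun k => q k * s ^ k) (fun k => INR k * (q k * s ^ k)) H)
    as [G HsG].
  - intros k. assert (0 <= q k * s ^ k)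
      by (apply Rmult_le_pos; [apply Hq0|now apply pow_le]).
    split; [assumption|]. destruct k as [|k]; [rewrite Hq00; simpl; lra|].
    assert (1 <= INR (S k)) by (apply (le_INR 1); lia). nra.
  - exact HsH.
  - exists G, H. split; assumption.
Qed.

Lemma log_sum_lower (eta : R) :
  0 < eta < 1 -> exists K, forall n, (1 <= n)%nat ->
    (1 - eta) * c0 * ln (INR n) - K <= sum_f_R0 (fun k => INR k * (q k * INR m ^ k)) n.
Proof.
  intros Heta. destruct (weight_asymp eta (proj1 Heta)) as (k0 & Hk0 & H).
  pose proof (INR_m_ge2 m Hm) as Hm2.
  assert (Hc : 0 < (1 - eta) * c0) by (apply Rmult_lt_0_compat; lra).
  exists ((1 - eta) * c0 * ln (INR k0)). intros n Hn.
  destruct (Nat.le_gt_cases k0 n) as [Hk|Hk].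
  - apply Rle_trans with ((1 - eta) * c0 * (ln (INR (S n)) - ln (INR k0))).
    + assert (ln (INR n) <= ln (INR (S n))).
      { apply ln_le; [apply (lt_INR 0); lia|apply le_INR; lia]. }
      nra.
    + clear Hn. induction Hk as [|n Hk IH].
      * pose proof (H k0 (le_n k0)) as [H1 _].
        pose proof (proj2 (ln_succ_bounds k0 Hk0)) as H2.
        apply Rle_trans with (INR k0 * (q k0 * INR m ^ k0)).
        -- apply Rle_trans with (2 := H1). apply Rmult_le_compat_l; lra.
        -- apply (sum_f_R0_ge_term (fun k => INR k * (q k * INR m ^ k)));
             [intros k; apply weight_ge0; lra|lia].
      * rewrite tech5. pose proof (H (S n) ltac:(lia)) as [H1 _].
        pose proof (proj2 (ln_succ_bounds (S n) ltac:(lia))) as H2.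
        assert ((1 - eta) * c0 * (ln (INR (S (S n))) - ln (INR (S n)))
          <= (1 - eta) * c0 * / INR (S n)) by (apply Rmult_le_compat_l; lra).
        lra.
  - assert (ln (INR n) <= ln (INR k0)).
    { apply ln_le; [apply (lt_INR 0); lia|apply le_INR; lia]. }
    apply Rle_trans with 0; [nra|].
    apply cond_pos_sum. intros k. apply weight_ge0. lra.
Qed.

Lemma log_sum_upper (eta : R) :
  0 < eta -> exists K, forall n, (1 <= n)%nat ->
    sum_f_R0 (fun k => INR k * (q k * INR m ^ k)) n <= (1 + eta) * c0 * ln (INR n) + K.
Proof.
  intros Heta. destruct (weight_asymp eta Heta) as (k0 & Hk0 & H).
  pose proof (INR_m_ge2 m Hm) as Hm2.
  assert (Hc : 0 < (1 + eta) * c0) by (apply Rmult_lt_0_compat; lra).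
  set (S0 := sum_f_R0 (fun k => INR k * (q k * INR m ^ k)) k0).
  exists S0. intros n Hn.
  assert (Hln : forall k, (1 <= k)%nat -> 0 <= ln (INR k)).
  { intros k Hk. rewrite <- ln_1. apply ln_le; [lra|].
    apply (le_INR 1) in Hk. exact Hk. }
  assert (M1 : forall a b, (a <= b)%nat ->
    sum_f_R0 (fun k => INR k * (q k * INR m ^ k)) a <=
    sum_f_R0 (fun k => INR k * (q k * INR m ^ k)) b).
  { intros a b Hab. induction Hab as [|b Hab IH]; [lra|].
    rewrite tech5. pose proof (weight_ge0 (INR m) (S b) ltac:(lra)). lra. }
  destruct (Nat.le_gt_cases k0 n) as [Hk|Hk].
  - clear Hn. induction Hk as [|n Hk IH].
    + fold S0. pose proof (Hln k0 Hk0). nra.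
    + rewrite tech5. pose proof (H (S n) ltac:(lia)) as [_ H1].
      pose proof (proj1 (ln_succ_bounds n ltac:(lia))) as H2.
      assert ((1 + eta) * c0 * / INR (S n) <=
        (1 + eta) * c0 * (ln (INR (S n)) - ln (INR n)))
        by (apply Rmult_le_compat_l; lra).
      lra.
  - pose proof (M1 n k0 ltac:(lia)) as HM. fold S0 in HM. pose proof (Hln n Hn). nra.
Qed.

(** Only indices up to [L / 2^a] are kept, where [x^k] is close to 1; this shortens the logarithm by
    [a ln 2], which goes into the constant. *)
Lemma critical_sum_lower (eta : R) :
  0 < eta < 1 -> exists K l1, forall l n, (l1 <= l)%nat -> (2 ^ l <= n)%nat ->
    (1 - eta) * ((INR m - 1) * c0) * (INR l * ln 2) - K <=
    (INR m * shrink l - 1) *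
      sum_f_R0 (fun k => INR k * (q k * (INR m * shrink l) ^ k)) n.
Proof.
  intros Heta. pose proof (INR_m_ge2 m Hm) as Hm2.
  destruct (log_sum_lower (eta / 3) ltac:(lra)) as [K HK].
  destruct (pow2_large (eta / 3) ltac:(lra)) as [a Ha].
  (* Three losses of a factor [b] occur: in the asymptotics of [q], in the damping [x^k], and in
     replacing [s - 1] by [m - 1]. Together they cost at most [1 - eta]. *)
  set (b := 1 - eta / 3) in *.
  assert (Hb : 2 / 3 < b < 1) by (unfold b; lra).
  assert (Hln2 : 0 < ln 2) by (rewrite <- ln_1; apply ln_increasing; lra).
  (* The threshold is [S a] rather than [a] because [m x - 1 >= (m - 1) b] needs
     [m / 2^(a+1) <= (m - 1) / 2^a], that is [m >= 2]. *)
  exists ((INR m - 1) * (c0 * INR a * ln 2 + Rabs K)), (S a).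
  intros l n Hl Hn.
  pose proof (shrink_bounds (S a) l Hl) as Hx.
  set (x := shrink l) in *.
  assert (Hx1 : b <= x).
  { destruct (shrink_bounds a l ltac:(lia)) as [H _]. fold x in H. unfold b. lra. }
  assert (Hs : (INR m - 1) * b <= INR m * x - 1).
  { simpl in Hx. rewrite Rinv_mult in Hx. unfold b in *. nra. }
  set (L := (2 ^ (l - a))%nat).
  assert (HL : (1 <= L)%nat) by (unfold L; pose proof (Nat.pow_nonzero 2 (l - a)); lia).
  assert (HLn : (L <= n)%nat).
  { apply Nat.le_trans with (2 := Hn). apply Nat.pow_le_mono_r; lia. }
  set (S1 := sum_f_R0 (fun k => INR k * (q k * (INR m * x) ^ k)) n).
  assert (HS1 : b * sum_f_R0 (fun k => INR k * (q k * INR m ^ k)) L <= S1).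
  { apply Rle_trans with (sum_f_R0 (fun k => INR k * (q k * (INR m * x) ^ k)) L).
    - rewrite scal_sum. apply sum_Rle. intros k Hk.
      rewrite Rpow_mult_distr.
      assert (Hxk : b <= x ^ k).
      { pose proof (shrink_pow_ge a l k Hk ltac:(lia)) as H. fold x in H. unfold b. lra. }
      pose proof (weight_ge0 (INR m) k ltac:(lra)). nra.
    - unfold S1. clear -HLn Hq0 Hm2 Hx1 Hb. induction HLn as [|n Hn IH]; [lra|].
      rewrite tech5. pose proof (weight_ge0 (INR m * x) (S n) ltac:(nra)). lra. }
  specialize (HK L HL). unfold L in HK at 1. rewrite ln_pow2, minus_INR in HK by lia.
  fold b in HK.
  set (S2 := sum_f_R0 (fun k => INR k * (q k * INR m ^ k)) L) in *.
  assert (HS2 : 0 <= S2) by (apply cond_pos_sum; intros k; apply weight_ge0; lra).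
  pose proof (Rle_abs K) as HKa.
  set (y := INR l * ln 2) in *.
  assert (Hy : 0 <= y) by (apply Rmult_le_pos; [apply pos_INR|lra]).
  assert (Hz : 0 <= INR a * ln 2) by (apply Rmult_le_pos; [apply pos_INR|lra]).
  assert (H1 : (INR m - 1) * (b * b * S2) <= (INR m * x - 1) * S1).
  { apply Rle_trans with ((INR m - 1) * b * S1).
    - replace ((INR m - 1) * (b * b * S2)) with ((INR m - 1) * b * (b * S2)) by ring.
      apply Rmult_le_compat_l; [nra|exact HS1].
    - apply Rmult_le_compat_r; [nra|exact Hs]. }
  apply Rle_trans with (2 := H1).
  replace ((1 - eta) * ((INR m - 1) * c0) * y -
    (INR m - 1) * (c0 * INR a * ln 2 + Rabs K)) with
    ((INR m - 1) * ((1 - eta) * c0 * y - c0 * (INR a * ln 2) - Rabs K)) by ring.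
  apply Rmult_le_compat_l; [lra|].
  assert (H2 : b * c0 * (y - INR a * ln 2) - Rabs K <= S2) by (unfold y in *; lra).
  assert (Hbb : 0 <= b * b <= 1) by nra.
  apply Rle_trans with (b * b * (b * c0 * (y - INR a * ln 2) - Rabs K));
    [|apply Rmult_le_compat_l; lra].
  assert (Hb3 : 1 - eta <= b * b * b) by (unfold b; nra).
  assert (Hb4 : b * b * b <= 1) by nra.
  assert (0 <= c0 * y) by nra. assert (0 <= c0 * (INR a * ln 2)) by nra.
  pose proof (Rabs_pos K).
  assert ((1 - eta) * (c0 * y) <= b * b * b * (c0 * y)) by (apply Rmult_le_compat_r; lra).
  assert (b * b * b * (c0 * (INR a * ln 2)) <= 1 * (c0 * (INR a * ln 2)))
    by (apply Rmult_le_compat_r; lra).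
  assert (b * b * Rabs K <= 1 * Rabs K) by (apply Rmult_le_compat_r; lra).
  lra.
Qed.

(** Up to [L = 2^l] the damping is ignored and the harmonic sum gives the logarithm. Beyond [L] the
    undamped weights are at most [B / L], and the geometric series of ratio [1 - 1/L] sums to [L],
    so the rest is at most [B]. *)
Lemma critical_sum_upper (eta : R) :
  0 < eta -> exists K, forall l G H, gf q (INR m * shrink l) G H ->
    H <= (1 + eta) * c0 * (INR l * ln 2) + K.
Proof.
  intros Heta. pose proof (INR_m_ge2 m Hm) as Hm2.
  destruct (log_sum_upper eta Heta) as [K HK].
  destruct weight_bounded as (B & HB & HW).
  exists (K + B). intros l G H [_ HH].
  pose proof (shrink_bounds 0 l ltac:(lia)) as Hx. simpl in Hx.
  set (L := (2 ^ l)%nat).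
  assert (HL : (1 <= L)%nat) by (unfold L; pose proof (Nat.pow_nonzero 2 l); lia).
  assert (HLR : INR L = 2 ^ l) by apply INR_pow2.
  assert (HL0 : 0 < 2 ^ l) by (apply pow_lt; lra).
  assert (Hinv : 1 - shrink l = / 2 ^ l) by (unfold shrink; ring).
  set (x := shrink l) in *.
  specialize (HK L HL). unfold L in HK at 2. rewrite ln_pow2 in HK.
  apply (series_le_bound _ _ _) with (2 := HH).
  set (t := fun k => if Nat.leb k L then INR k * (q k * INR m ^ k) else 0).
  assert (Ht0 : forall k, 0 <= t k).
  { intros k. unfold t. destruct (Nat.leb k L); [apply weight_ge0; lra|lra]. }
  intros n.
  apply Rle_trans with (sum_f_R0 t n + B * / 2 ^ l * sum_f_R0 (fun k => x ^ k) n).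
  - rewrite scal_sum, <- sum_plus. apply sum_Rle. intros k _.
    rewrite Rpow_mult_distr. pose proof (pow_le x k ltac:(lra)) as Hxk.
    assert (Hxk1 : x ^ k <= 1).
    { apply Rle_trans with (1 ^ k); [apply pow_incr; lra|rewrite pow1; lra]. }
    pose proof (weight_ge0 (INR m) k ltac:(lra)) as Hw.
    replace (INR k * (q k * (INR m ^ k * x ^ k))) with
      (INR k * (q k * INR m ^ k) * x ^ k) by ring.
    assert (0 < / 2 ^ l) by now apply Rinv_0_lt_compat.
    unfold t. destruct (Nat.leb_spec k L) as [Hk|Hk].
    + assert (0 <= x ^ k * (B * / 2 ^ l)) by (apply Rmult_le_pos; nra). nra.
    + rewrite Rplus_0_l, (Rmult_comm (x ^ k)). apply Rmult_le_compat_r; [exact Hxk|].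
      apply lt_INR in Hk. rewrite HLR in Hk.
      apply Rmult_le_reg_l with (2 ^ l); [exact HL0|].
      replace (2 ^ l * (B * / 2 ^ l)) with B by (field; lra).
      apply Rle_trans with (2 := HW k). apply Rmult_le_compat_r; lra.
  - assert (H1 : sum_f_R0 t n <= sum_f_R0 (fun k => INR k * (q k * INR m ^ k)) L).
    { replace (sum_f_R0 (fun k => INR k * (q k * INR m ^ k)) L) with (sum_f_R0 t L).
      - assert (Hz : forall k, (L < k)%nat -> t k = 0).
        { intros k Hk. unfold t. destruct (Nat.leb_spec k L); [lia|reflexivity]. }
        apply (series_ge_partial t _ n Ht0 (series_finite t L Hz)).
      - apply sum_eq. intros k Hk. unfold t. destruct (Nat.leb_spec k L); [reflexivity|lia]. }
    assert (H2 : B * / 2 ^ l * sum_f_R0 (fun k => x ^ k) n <= B).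
    { rewrite Rinv_1 in Hx. pose proof (geom_sum_le x n ltac:(lra)) as Hg.
      rewrite Hinv, Rinv_inv in Hg.
      apply Rle_trans with (B * / 2 ^ l * 2 ^ l).
      - apply Rmult_le_compat_l; [|exact Hg].
        apply Rmult_le_pos; [lra|apply Rlt_le, Rinv_0_lt_compat, HL0].
      - right. field. lra. }
    lra.
Qed.

End Tail.

(** * The mixture at scale 2^l *)

Lemma exp_INR_mult (n : nat) (x : R) : exp (INR n * x) = exp x ^ n.
Proof.
  induction n as [|n IH]; [simpl; rewrite Rmult_0_l; apply exp_0|].
  rewrite S_INR, Rmult_plus_distr_r, Rmult_1_l, exp_plus, IH. simpl. ring.
Qed.

(** [4^l >= e^l = (e^(l/4))^4 >= (l/4)^4], one power of [l] more than needed; 256 is [4^4]. *)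
Lemma cubic_lt_pow4 (K e : R) :
  0 < e -> exists l0, forall l, (l0 <= l)%nat -> K * INR l ^ 3 < e * 4 ^ l.
Proof.
  intros He. destruct (INR_unbounded (256 * Rabs K / e)) as [l0 Hl0].
  exists (S l0). intros l Hl.
  apply (le_INR (S l0)) in Hl. rewrite S_INR in Hl.
  set (y := INR l) in *. pose proof (pos_INR l0).
  assert (Hy : 0 < y / 4) by lra.
  assert (H4 : (y / 4) ^ 4 <= 4 ^ l).
  { apply Rle_trans with (exp 1 ^ l).
    - rewrite <- exp_INR_mult. fold y.
      replace (y * 1) with (INR 4 * (y / 4)) by (simpl; field).
      rewrite exp_INR_mult. apply pow_incr. pose proof (exp_ineq1_le (y / 4)). lra.
    - apply pow_incr. pose proof exp_le_3. pose proof (exp_pos 1). lra. }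
  assert (HK : 256 * Rabs K < e * y).
  { apply Rmult_lt_reg_r with (/ e); [now apply Rinv_0_lt_compat|].
    replace (e * y * / e) with y by (field; lra). unfold Rdiv in Hl0. lra. }
  pose proof (Rle_abs K). assert (0 < y ^ 3) by (apply pow_lt; lra).
  apply Rlt_le_trans with (e * (y / 4) ^ 4); [|apply Rmult_le_compat_l; lra].
  replace (e * (y / 4) ^ 4) with (e * y / 256 * y ^ 3) by field.
  apply Rmult_lt_compat_r; lra.
Qed.

(* The factors 5 give [shrink l ^ height l <= 2^(-5l)] and drift growth by [2^(5l)] up
   to the horizon, both of which beat the cubic power of [2^l] lost elsewhere. *)
Definition height (l : nat) : nat := 5 * l * 2 ^ l.
Definition horizon (m l : nat) : nat :=
  6 * (m - 1) * height l * (5 * l) + m * height l.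

Lemma free_energy_lower_scale (m : nat) (e0 : R) :
  (2 <= m)%nat -> 0 < e0 -> exists l0, forall l f0 G0 H0 F,
    (l0 <= l)%nat -> pmf f0 ->
    gf (trunc (height l) f0) (INR m * shrink l) G0 H0 ->
    e0 <= (INR m * shrink l - 1) * H0 - G0 ->
    free_energy m f0 F -> / INR m ^ horizon m l <= F.
Proof.
  intros Hm He0. pose proof (INR_m_ge2 m Hm) as Hm2.
  set (M := INR m) in *.
  assert (HM4 : 0 < M ^ 4) by (apply pow_lt; lra).
  (* The truncation condition multiplies three factors [5 l 2^l] by 2, by 6 and by [m^8], whence
     1500 and the cube of [l]; the powers of [2^l] combine with [2^(-5l)] to [4^(-l)]. *)
  destruct (cubic_lt_pow4 (1500 * (M ^ 4 * M ^ 4)) e0 He0) as [l1 Hl1].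
  exists (l1 + 2)%nat. intros l f0 G0 H0 F Hl Hf0 HG Hd HF.
  specialize (Hl1 l ltac:(lia)).
  assert (Hl2 : 2 <= INR l) by (apply (le_INR 2); lia).
  assert (H2l : 1 <= 2 ^ l) by (apply pow_R1_Rle; lra).
  set (N := height l) in *.
  assert (HN : INR N = 5 * INR l * 2 ^ l).
  { unfold N, height. rewrite 2!mult_INR, INR_pow2. simpl. ring. }
  assert (HN1 : 10 <= INR N) by (rewrite HN; nra).
  assert (HNn : (1 <= N)%nat) by (apply INR_le; simpl; lra).
  assert (H4 : 4 ^ l = 2 ^ l * 2 ^ l).
  { rewrite <- Rpow_mult_distr. f_equal; lra. }
  assert (Hx : 3 / 4 <= shrink l <= 1).
  { pose proof (shrink_bounds 2 l ltac:(lia)). simpl in *. lra. }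
  assert (HxN : shrink l ^ N <= / (2 ^ l) ^ 5).
  { unfold N, height. replace (5 * l * 2 ^ l)%nat with (2 ^ l * (l * 5))%nat by ring.
    rewrite pow_mult, <- pow_mult.
    apply Rle_trans with ((/ 2) ^ (l * 5)).
    - rewrite pow_mult. apply pow_incr. split; [apply pow_le; lra|].
      unfold shrink. apply pow_one_minus_le_half; [apply inv_pow2_le1|].
      rewrite INR_pow2, Rinv_r by lra. lra.
    - rewrite pow_inv, pow_mult. lra. }
  set (P := 2 ^ l) in *. set (y := INR l) in *.
  assert (HMN : INR (m * N) = M * INR N) by (rewrite mult_INR; reflexivity).
  assert (HT : INR (6 * (m - 1) * N) = 6 * (M - 1) * INR N).
  { rewrite 2!mult_INR, minus_INR by lia. simpl. fold M. lra. }
  assert (HMN4 : 0 <= M * INR N * M ^ 4)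
    by (apply Rmult_le_pos; [apply Rmult_le_pos|]; lra).
  apply (free_energy_lower m N f0 (shrink l) e0 G0 H0 F
    (6 * (m - 1) * N * (5 * l)) Hm HNn Hf0 Hx He0); fold M; try assumption.
  - rewrite S_INR, HMN.
    apply Rmult_le_reg_r with (6 * (M - 1) * INR N); [nra|].
    replace (e0 * / (6 * (M - 1) * INR N) * (6 * (M - 1) * INR N)) with e0
      by (field; lra).
    apply Rle_trans with
      (M * (M * INR N * M ^ 4 * / P ^ 5 * (2 * M * INR N)) * (6 * M * INR N)).
    + assert (0 <= M * INR N * M ^ 4 * shrink l ^ N).
      { apply Rmult_le_pos; [exact HMN4|apply pow_le; lra]. }
      assert (M * INR N * M ^ 4 * shrink l ^ N <= M * INR N * M ^ 4 * / P ^ 5).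
      { apply Rmult_le_compat_l; [exact HMN4|exact HxN]. }
      assert (0 <= M * INR N + 1) by nra.
      apply Rmult_le_compat; [|nra| |nra].
      * apply Rmult_le_pos; [lra|]. now apply Rmult_le_pos.
      * apply Rmult_le_compat; [lra| |lra|].
        -- now apply Rmult_le_pos.
        -- apply Rmult_le_compat; [assumption|assumption|assumption|nra].
    + rewrite HN.
      replace (M * (M * (5 * y * P) * M ^ 4 * / P ^ 5 * (2 * M * (5 * y * P))) *
        (6 * M * (5 * y * P))) with (1500 * (M ^ 4 * M ^ 4) * y ^ 3 * / (P * P))
        by (field; lra).
      apply Rmult_le_reg_r with (P * P); [nra|].
      rewrite Rmult_assoc, Rinv_l by nra. rewrite <- H4. lra.
  - rewrite S_INR.
    set (rho := / (6 * (M - 1) * INR N)).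
    assert (Hrho : 0 < rho) by (apply Rinv_0_lt_compat; nra).
    (* The exponent is [1/rho], so by Bernoulli the drift at least doubles over each such block; the
       horizon contains [5 l] blocks. *)
    assert (H2 : 2 <= (1 + rho) ^ (6 * (m - 1) * N)).
    { apply Rle_trans with (2 := poly _ rho Hrho). rewrite HT. unfold rho.
      rewrite Rinv_r by nra. lra. }
    assert (HP : P ^ 5 <= (1 + rho) ^ (6 * (m - 1) * N * (5 * l))).
    { rewrite pow_mult. unfold P. rewrite <- pow_mult.
      replace (l * 5)%nat with (5 * l)%nat by ring. apply pow_incr. lra. }
    apply Rlt_le_trans with (e0 * P ^ 5); [|apply Rmult_le_compat_l; lra].
    apply Rle_lt_trans with (M * (INR N * M ^ 4 * (2 * INR N))).
    { apply Rmult_le_compat; [lra| |lra|]; [apply Rmult_le_pos; nra|].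
      apply Rmult_le_compat_l; nra. }
    rewrite HN.
    apply Rle_lt_trans with (1500 * (M ^ 4 * M ^ 4) * y ^ 3 * (P * P)).
    + replace (M * (5 * y * P * M ^ 4 * (2 * (5 * y * P)))) with
        (50 * (M ^ 4 * M) * (y ^ 2) * (P * P)) by ring.
      apply Rmult_le_compat_r; [nra|].
      assert (M <= M ^ 4) by (rewrite <- (pow_1 M) at 1; apply Rle_pow; [lra|lia]).
      assert (y ^ 2 <= y ^ 3) by (apply Rle_pow; [lra|lia]).
      assert (0 < y ^ 2) by (apply pow_lt; lra).
      apply Rmult_le_compat; nra.
    + apply Rlt_le_trans with (e0 * 4 ^ l * (P * P)).
      * apply Rmult_lt_compat_r; nra.
      * rewrite H4. replace (e0 * P ^ 5) with (e0 * (P * P) * (P * P) * P) by ring.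
        assert (0 <= e0 * (P * P) * (P * P)).
        { apply Rmult_le_pos; [|nra]. apply Rmult_le_pos; nra. }
        nra.
Qed.

Lemma pmf_mix (p : R) (q : nat -> R) : 0 <= p <= 1 -> pmf q -> pmf (mix p q).
Proof.
  intros Hp [H0 H1]. split.
  - intros k. unfold mix. pose proof (dirac0_ge0 k). specialize (H0 k). nra.
  - assert (HD : is_series dirac0 1).
    { eapply series_ext; [| |exact (proj1 (gf_dirac0 1))]; [|reflexivity].
      intros k; simpl. rewrite pow1. ring. }
    eapply series_ext; [| |exact (series_linear _ _ (1 - p) p _ _ HD H1)];
      [reflexivity|ring].
Qed.

Lemma gf_mix (p : R) (q : nat -> R) (s G H : R) :
  gf q s G H -> gf (mix p q) s (1 - p + p * G) (p * H).
Proof.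
  intros HG. eapply gf_ext;
    [| | |exact (gf_linear _ _ _ (1 - p) p _ _ _ _ (gf_dirac0 s) HG)];
    [reflexivity|ring|ring].
Qed.

(** The mass moved to 0 has no weight in [H], which is therefore an exact partial sum. In [G] the
    atom at 0 contributes at most 1. *)
Lemma trunc_mix_gf (p : R) (q : nat -> R) (s : R) (N : nat) :
  0 <= p <= 1 -> pmf q -> 0 <= s ->
  exists G, gf (trunc N (mix p q)) s G
      (p * sum_f_R0 (fun k => INR k * (q k * s ^ k)) N) /\
    G <= 1 + p * sum_f_R0 (fun k => q k * s ^ k) N.
Proof.
  intros Hp Hq Hs. pose proof (pmf_mix p q Hp Hq) as Hmix.
  exists (sum_f_R0 (fun k => trunc N (mix p q) k * s ^ k) N). split; [split|].
  - apply (series_finite (fun k => trunc N (mix p q) k * s ^ k)).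
    intros k Hk. rewrite trunc_support by exact Hk. ring.
  - eapply series_ext; [reflexivity| |
      apply (series_finite (fun k => INR k * (trunc N (mix p q) k * s ^ k)) N)].
    + rewrite scal_sum. apply sum_eq. intros [|k] Hk; [simpl; ring|].
      unfold trunc, mix. destruct (Nat.leb_spec (S k) N); [|lia].
      change (dirac0 (S k)) with 0. ring.
    + intros k Hk. rewrite trunc_support by exact Hk. ring.
  - replace 1 with (sum_f_R0 dirac0 N) at 1.
    2: { rewrite (sum_f_R0_finite dirac0 0 N); [reflexivity| |lia].
         intros [|k] Hk; [lia|reflexivity]. }
    rewrite scal_sum, <- sum_plus. apply sum_Rle. intros [|k] Hk.
    + pose proof (sum_f_R0_ge_term (mix p q) 0 N (proj1 Hmix) ltac:(lia)).
      pose proof (proj1 Hq 0%nat). simpl. nra.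
    + unfold trunc, mix. destruct (Nat.leb_spec (S k) N); [|lia].
      change (dirac0 (S k)) with 0. right. ring.
Qed.

Section Mixture.
Variables (m : nat) (q : nat -> R) (c0 : R).
Hypothesis (Hm : (2 <= m)%nat) (Hq0 : forall k, 0 <= q k) (Hq00 : q 0%nat = 0)
  (Hq1 : infinite_sum q 1) (Hc0 : 0 < c0)
  (Hqcv : Un_cv (fun k => q k / (c0 * / (INR m ^ k) * / (INR k ^ 2))) 1).

Lemma mix_free_energy_ex (p : R) :
  0 <= p <= 1 -> exists F, free_energy m (mix p q) F.
Proof.
  intros Hp. pose proof (INR_m_ge2 m Hm) as Hm2.
  pose proof (pmf_mix p q Hp (pmf_q q Hq0 Hq1)) as Hmix.
  destruct (gf_q m q c0 Hm Hq0 Hq00 Hq1 Hc0 Hqcv 1 ltac:(lra)) as (G & H & HG).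
  assert (G = 1).
  { apply (series_unique _ _ _ (proj1 HG)).
    eapply series_ext; [|reflexivity|exact (proj2 (pmf_q q Hq0 Hq1))].
    intros k; simpl. rewrite pow1. ring. }
  subst G. pose proof (gf_mix p _ _ _ _ HG) as HG'.
  replace (1 - p + p * 1) with 1 in HG' by ring.
  destruct (gf_1_pmf _ _ (proj1 Hmix) HG') as [_ Hmu].
  exact (free_energy_ex m _ Hm Hmix _ Hmu).
Qed.

(** The margin [e0], the constant [K] and the threshold [l0] are fixed before [p], so that [l] may
    later be tied to [p]. *)
Lemma mix_lower (eta e0 : R) :
  0 < eta < 1 -> 0 < e0 -> exists K l0, 0 < K /\ forall l p F,
    (l0 <= l)%nat -> 0 < p <= 1 ->
    1 + e0 + p * K <= p * ((1 - eta) * ((INR m - 1) * c0) * (INR l * ln 2)) ->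
    free_energy m (mix p q) F -> / INR m ^ horizon m l <= F.
Proof.
  intros Heta He0. pose proof (INR_m_ge2 m Hm) as Hm2.
  destruct (critical_sum_lower m q c0 Hm Hq0 Hc0 Hqcv eta Heta) as (K & l1 & HK).
  destruct (mass_sum_bounded m q c0 Hm Hq0 Hq00 Hq1 Hc0 Hqcv) as (Q & HQ & HQb).
  destruct (free_energy_lower_scale m e0 Hm He0) as [l2 Hl2].
  exists (Rabs K + Q), (l1 + l2 + 1)%nat. split; [pose proof (Rabs_pos K); lra|].
  intros l p F Hl Hp Hcond HF.
  pose proof (pmf_q q Hq0 Hq1) as Hq.
  pose proof (shrink_bounds 0 l ltac:(lia)) as Hx. simpl in Hx. rewrite Rinv_1 in Hx.
  destruct (trunc_mix_gf p q (INR m * shrink l) (height l) ltac:(lra) Hq ltac:(nra))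
    as (G & HG & HGle).
  apply (Hl2 l (mix p q) G _ F ltac:(lia) (pmf_mix p q ltac:(lra) Hq) HG); [|exact HF].
  assert (Hh : (2 ^ l <= height l)%nat) by (unfold height; nia).
  specialize (HK l (height l) ltac:(lia) Hh).
  set (S1 := sum_f_R0 (fun k => INR k * (q k * (INR m * shrink l) ^ k)) (height l)) in *.
  assert (HS2 : sum_f_R0 (fun k => q k * (INR m * shrink l) ^ k) (height l) <= Q).
  { apply Rle_trans with (2 := HQb (height l)). apply sum_Rle. intros k _.
    apply Rmult_le_compat_l; [apply Hq0|]. apply pow_incr. nra. }
  pose proof (Rle_abs K).
  assert (p * sum_f_R0 (fun k => q k * (INR m * shrink l) ^ k) (height l) <= p * Q)
    by (apply Rmult_le_compat_l; lra).
  assert (p * ((1 - eta) * ((INR m - 1) * c0) * (INR l * ln 2) - Rabs K) <=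
    p * ((INR m * shrink l - 1) * S1)) by (apply Rmult_le_compat_l; lra).
  lra.
Qed.

(** Over [2^(l - a)] steps [(m / s)] accumulates to at most [1 / (1 - 2^(-a))]. Since [G >= 1], the
    slack [2^(-a)] in the condition on [p] absorbs this. *)
Lemma mix_upper (eta : R) (a : nat) :
  0 < eta -> exists K l0, 0 < K /\ forall l p F,
    (l0 <= l)%nat -> 0 < p <= 1 ->
    p * ((1 + eta) * ((INR m - 1) * c0) * (INR l * ln 2) + K) <= 1 - / 2 ^ a ->
    free_energy m (mix p q) F -> F <= 4 * INR m / INR m ^ (2 ^ (l - a)).
Proof.
  intros Heta. pose proof (INR_m_ge2 m Hm) as Hm2.
  destruct (critical_sum_upper m q c0 Hm Hq0 Hq1 Hc0 Hqcv eta Heta) as (K & HK).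
  assert (H4m : 0 < / (4 * INR m)) by (apply Rinv_0_lt_compat; lra).
  (* The integer [b] ensures [m - s <= 1/4], as [free_energy_upper] requires. *)
  destruct (pow2_large (/ (4 * INR m)) H4m) as [b Hb].
  pose proof (Rabs_pos K).
  exists ((INR m - 1) * (Rabs K + 1)), (a + b)%nat. split; [nra|].
  intros l p F Hl Hp Hcond HF.
  pose proof (pmf_q q Hq0 Hq1) as Hq.
  pose proof (shrink_bounds b l ltac:(lia)) as Hx.
  assert (Hms : INR m - INR m * shrink l <= 1 / 4).
  { assert (INR m * (1 - shrink l) <= INR m * / (4 * INR m))
      by (apply Rmult_le_compat_l; lra).
    assert (INR m * / (4 * INR m) = 1 / 4) by (field; lra). lra. }
  set (s := INR m * shrink l) in *.
  assert (Hs : 7 / 4 <= s <= INR m) by (unfold s in *; nra).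
  assert (Hsm : s < INR m) by (unfold s; nra).
  destruct (gf_q m q c0 Hm Hq0 Hq00 Hq1 Hc0 Hqcv s ltac:(lra)) as (G & H1 & HG).
  specialize (HK l G H1 HG).
  pose proof (pmf_mix p q ltac:(lra) Hq) as Hmix.
  pose proof (gf_mix p q s G H1 HG) as HGm.
  assert (H1G := gf_ge_mass _ s _ _ Hmix ltac:(lra) HGm).
  apply (free_energy_upper m (mix p q) s _ _ F (2 ^ (l - a)) Hm Hmix Hs Hms HGm);
    [|exact HF].
  apply Rle_trans with (2 := H1G).
  assert (Hpow := shrink_pow_ge a l (2 ^ (l - a)) ltac:(lia) ltac:(lia)).
  assert (Hx0 : 0 < shrink l) by (unfold s in Hs; nra).
  replace (INR m / s) with (/ shrink l) by (unfold s; field; lra).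
  rewrite pow_inv. set (t := shrink l ^ 2 ^ (l - a)) in *.
  assert (Ht : 0 < t) by (apply pow_lt, Hx0).
  apply Rmult_le_reg_r with t; [exact Ht|].
  rewrite Rmult_assoc, Rinv_l by lra. rewrite Rmult_1_l, Rmult_1_r.
  apply Rle_trans with (2 := Hpow). apply Rle_trans with (2 := Hcond).
  pose proof (Rle_abs K).
  assert (HH0 : 0 <= H1).
  { pose proof (series_ge_partial _ _ 0
      (fun k => weight_ge0 q Hq0 s k ltac:(lra)) (proj2 HG)) as H'. simpl in H'. lra. }
  apply Rle_trans with (p * ((INR m - 1) * H1)).
  - assert (0 <= p * H1) by nra. nra.
  - apply Rmult_le_compat_l; [lra|].
    apply Rle_trans with ((INR m - 1) * ((1 + eta) * c0 * (INR l * ln 2) + K)).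
    + apply Rmult_le_compat_l; lra.
    + nra.
Qed.

End Mixture.

(** * The free energy as p tends to 0 *)

Lemma nat_floor (x : R) : 0 <= x -> exists n, INR n <= x < INR n + 1.
Proof.
  intros Hx. destruct (nfloor_ex x Hx) as [n Hn]. exists n. lra.
Qed.

Lemma exp_ge_cube (x : R) : 0 <= x -> (x / 3) ^ 3 <= exp x.
Proof.
  intros Hx. replace x with (INR 3 * (x / 3)) at 2 by (simpl; field).
  rewrite exp_INR_mult. apply pow_incr. pose proof (exp_ineq1_le (x / 3)). lra.
Qed.

Lemma exp_le (x y : R) : x <= y -> exp x <= exp y.
Proof.
  intros [H|<-]; [apply Rlt_le, exp_increasing, H|apply Rle_refl].
Qed.

Lemma pow2_exp (l : nat) : 2 ^ l = exp (INR l * ln 2).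
Proof. rewrite exp_INR_mult, exp_ln by lra. reflexivity. Qed.

Lemma pow_exp_ln (x : R) (n : nat) : 0 < x -> x ^ n = exp (INR n * ln x).
Proof. intros Hx. rewrite exp_INR_mult, exp_ln by exact Hx. reflexivity. Qed.

Lemma ln2_bounds : 1 / 2 <= ln 2 <= 1.
Proof.
  split.
  - pose proof (exp_ineq1_le (- ln 2)) as H.
    rewrite exp_Ropp, exp_ln in H by lra. lra.
  - pose proof (exp_ineq1_le (ln 2 - 0)) as H. rewrite Rminus_0_r, exp_ln in H; lra.
Qed.

Section Asymptotics.
Variables (m : nat) (q : nat -> R) (c0 : R).
Hypothesis (Hm : (2 <= m)%nat) (Hq0 : forall k, 0 <= q k) (Hq00 : q 0%nat = 0)
  (Hq1 : infinite_sum q 1) (Hc0 : 0 < c0)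
  (Hqcv : Un_cv (fun k => q k / (c0 * / (INR m ^ k) * / (INR k ^ 2))) 1).

Lemma free_energy_positive (p F : R) :
  0 < p <= 1 -> free_energy m (mix p q) F -> 0 < F.
Proof.
  intros Hp HF. pose proof (INR_m_ge2 m Hm) as Hm2. pose proof ln2_bounds as Hln.
  destruct (mix_lower m q c0 Hm Hq0 Hq00 Hq1 Hc0 Hqcv (1 / 2) 1 ltac:(lra) ltac:(lra))
    as (K & l0 & HK & H).
  set (beta := (INR m - 1) * c0) in *.
  assert (Hb : 0 < beta) by (apply Rmult_lt_0_compat; lra).
  assert (Hpb : 0 < p * beta) by (apply Rmult_lt_0_compat; lra).
  destruct (INR_unbounded ((2 + p * K) * 4 / (p * beta))) as [l1 Hl1].
  apply Rlt_le_trans with (/ INR m ^ horizon m (l0 + l1)).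
  - apply Rinv_0_lt_compat, pow_lt. lra.
  - apply (H (l0 + l1)%nat p F); [lia|exact Hp| |exact HF].
    rewrite plus_INR.
    assert (H1 : (2 + p * K) * 4 < INR l1 * (p * beta)).
    { apply Rmult_lt_reg_r with (/ (p * beta)); [now apply Rinv_0_lt_compat|].
      replace (INR l1 * (p * beta) * / (p * beta)) with (INR l1) by (field; lra).
      unfold Rdiv in Hl1. lra. }
    pose proof (pos_INR l0).
    assert (H2 : INR l1 * (1 / 2) <= (INR l0 + INR l1) * ln 2)
      by (apply Rmult_le_compat; pose proof (pos_INR l1); lra).
    assert (p * beta * (INR l1 * (1 / 2)) <= p * beta * ((INR l0 + INR l1) * ln 2))
      by (apply Rmult_le_compat_l; lra).
    lra.
Qed.

(** Half of [e] makes the drift positive, through [ln L] about [(C + e/2)/p]. The other half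
    supplies [exp (e / (2p))], which absorbs the polynomial factor in the horizon. *)
Lemma free_energy_log_lower (e : R) :
  0 < e -> exists delta, 0 < delta /\ forall p F,
    0 < p < delta -> p <= 1 -> free_energy m (mix p q) F ->
    exp (- exp ((/ ((INR m - 1) * c0) + e) / p)) <= F.
Proof.
  intros He. pose proof (INR_m_ge2 m Hm) as Hm2. pose proof ln2_bounds as Hln.
  set (beta := (INR m - 1) * c0) in *.
  assert (Hb : 0 < beta) by (apply Rmult_lt_0_compat; lra).
  set (u := beta * (e / 2)).
  assert (Hu : 0 < u) by (unfold u; nra).
  set (eta := u / (2 * (1 + u))).
  assert (Heta : 0 < eta < 1).
  { unfold eta. split; [apply Rdiv_lt_0_compat; lra|].
    apply Rmult_lt_reg_r with (2 * (1 + u)); [lra|].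
    unfold Rdiv. rewrite Rmult_assoc, Rinv_l by lra. lra. }
  (* Since [beta A = 1 + u], this choice of [eta] leaves a surplus [u/2], shared equally between the
     margin [e0 = u/4] and the error [p K]. *)
  assert (Heu : (1 - eta) * (1 + u) = 1 + u / 2) by (unfold eta; field; lra).
  destruct (mix_lower m q c0 Hm Hq0 Hq00 Hq1 Hc0 Hqcv eta (u / 4) Heta ltac:(lra))
    as (K & l0 & HK & H). fold beta in H.
  set (C := / beta).
  assert (HC : 0 < C) by now apply Rinv_0_lt_compat.
  assert (HCb : beta * C = 1) by (unfold C; field; lra).
  set (A := C + e / 2).
  assert (HA : 0 < A) by (unfold A; lra).
  set (M := INR m) in *.
  assert (HlnM : 0 < ln M) by (rewrite <- ln_1; apply ln_increasing; lra).
  (* [W] will bound [l p]. The cubic bound on [exp] turns the factor [l^2 <= (W/p)^2] into [W^2]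
     with one power of [p] to spare, which defeats the constant [Z]; 216 is [(2 * 3)^3]. *)
  set (W := 2 * A + 1).
  set (Z := 155 * M * (W * W) * 2 * ln M).
  assert (HZ : 0 < Z).
  { unfold Z, W. repeat apply Rmult_lt_0_compat; lra. }
  set (d1 := u / (4 * K)). set (d2 := A / (INR l0 + 1)).
  set (d3 := e * e * e / (216 * Z)).
  pose proof (pos_INR l0) as Hl0.
  assert (Hd1 : 0 < d1) by (apply Rdiv_lt_0_compat; lra).
  assert (Hd2 : 0 < d2) by (apply Rdiv_lt_0_compat; lra).
  assert (Hd3 : 0 < d3).
  { apply Rdiv_lt_0_compat; [|lra]. repeat apply Rmult_lt_0_compat; lra. }
  exists (Rmin d1 (Rmin d2 d3)). split; [repeat apply Rmin_glb_lt; assumption|].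
  intros p F [Hp Hpd] Hp1 HF.
  pose proof (Rmin_l d1 (Rmin d2 d3)). pose proof (Rmin_r d1 (Rmin d2 d3)).
  pose proof (Rmin_l d2 d3). pose proof (Rmin_r d2 d3).
  assert (Hpd1 : p * K <= u / 4).
  { apply Rle_trans with (d1 * K); [apply Rmult_le_compat_r; lra|].
    right. unfold d1. field. lra. }
  assert (Hpd2 : INR l0 * p <= A).
  { apply Rle_trans with ((INR l0 + 1) * d2).
    - apply Rmult_le_compat; lra.
    - right. unfold d2. field. lra. }
  assert (Hpd3 : p * Z <= e * e * e / 216).
  { apply Rle_trans with (d3 * Z); [apply Rmult_le_compat_r; lra|].
    right. unfold d3. field. lra. }
  set (y := A / p).
  assert (Hy : 0 < y) by (apply Rdiv_lt_0_compat; lra).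
  assert (Hpy : p * y = A) by (unfold y; field; lra).
  destruct (nat_floor (y / ln 2)) as [l' [Hl1 Hl2]].
  { apply Rlt_le, Rdiv_lt_0_compat; lra. }
  set (l := S l').
  assert (Hyl : y <= INR l * ln 2).
  { unfold l. rewrite S_INR. apply Rmult_le_reg_r with (/ ln 2).
    - apply Rinv_0_lt_compat; lra.
    - replace ((INR l' + 1) * ln 2 * / ln 2) with (INR l' + 1) by (field; lra).
      unfold Rdiv in Hl2. lra. }
  assert (Hyl' : INR l * ln 2 <= y + ln 2).
  { unfold l. rewrite S_INR. assert (INR l' * ln 2 <= y); [|lra].
    apply Rle_trans with (y / ln 2 * ln 2); [apply Rmult_le_compat_r; lra|].
    right. field. lra. }
  assert (Hll0 : (l0 <= l)%nat).
  { apply INR_le. apply Rle_trans with y.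
    - apply Rmult_le_reg_r with p; [exact Hp|]. lra.
    - pose proof (pos_INR l). nra. }
  assert (Hlow : / M ^ horizon m l <= F).
  { apply (H l p F Hll0 (conj Hp Hp1)); [|exact HF].
    apply Rle_trans with (p * ((1 - eta) * beta * y)).
    - replace (p * ((1 - eta) * beta * y)) with ((1 - eta) * (beta * (p * y))) by ring.
      rewrite Hpy. unfold A. rewrite Rmult_plus_distr_l, HCb. fold u. lra.
    - apply Rmult_le_compat_l; [lra|]. apply Rmult_le_compat_l; [nra|exact Hyl]. }
  apply Rle_trans with (2 := Hlow).
  rewrite (pow_exp_ln M) by lra. rewrite <- exp_Ropp. apply exp_le, Ropp_le_contravar.
  (* the horizon is [O (l^2 2^l)] with [l = O (1/p)] *)
  assert (Hlp : INR l * p <= W).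
  { assert (INR l' <= 2 * y).
    { pose proof (pos_INR l'). assert (INR l' * ln 2 <= y) by
        (unfold l in Hyl'; rewrite S_INR in Hyl'; lra). nra. }
    unfold l. rewrite S_INR. unfold W.
    assert (INR l' * p <= 2 * y * p) by (apply Rmult_le_compat_r; lra). lra. }
  assert (Hhor : INR (horizon m l) <= 155 * M * (INR l * INR l) * 2 ^ l).
  { unfold horizon, height.
    rewrite plus_INR, !mult_INR, minus_INR, INR_pow2 by lia. fold M.
    replace (INR 6) with 6 by (simpl; ring). replace (INR 5) with 5 by (simpl; ring).
    change (INR 1) with 1.
    assert (1 <= INR l) by (unfold l; apply (le_INR 1); lia).
    assert (H2l : 0 < 2 ^ l) by (apply pow_lt; lra).
    set (z := INR l) in *. set (P := 2 ^ l) in *.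
    assert (0 <= M * z * P) by (apply Rmult_le_pos; [apply Rmult_le_pos|]; lra).
    assert (M * z * P * 1 <= M * z * P * z) by (apply Rmult_le_compat_l; lra).
    assert (0 <= z * P * z) by (apply Rmult_le_pos; [apply Rmult_le_pos|]; lra).
    lra. }
  assert (H2l : 2 ^ l <= 2 * exp y).
  { rewrite pow2_exp. apply Rle_trans with (exp (y + ln 2)); [now apply exp_le|].
    rewrite exp_plus, exp_ln by lra. lra. }
  replace ((C + e) / p) with (y + e / 2 / p) by (unfold y, A; field; lra).
  rewrite exp_plus. set (X := exp y) in *.
  assert (HX : 0 < X) by apply exp_pos.
  pose proof (exp_ge_cube (e / 2 / p)) as Hcube.
  specialize (Hcube ltac:(apply Rlt_le; repeat apply Rdiv_lt_0_compat; lra)).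
  apply Rle_trans with (X * (e / 2 / p / 3) ^ 3);
    [|apply Rmult_le_compat_l; [lra|exact Hcube]].
  apply Rle_trans with (155 * M * (INR l * INR l) * (2 * X) * ln M).
  { apply Rmult_le_compat_r; [lra|]. apply Rle_trans with (1 := Hhor).
    apply Rmult_le_compat_l; [|exact H2l].
    pose proof (pos_INR l). repeat apply Rmult_le_pos; lra. }
  apply Rmult_le_reg_r with (p * p * p); [repeat apply Rmult_lt_0_compat; lra|].
  replace (X * (e / 2 / p / 3) ^ 3 * (p * p * p)) with (X * (e * e * e / 216))
    by (field; lra).
  replace (155 * M * (INR l * INR l) * (2 * X) * ln M * (p * p * p)) with
    (X * (155 * M * ((INR l * p) * (INR l * p)) * 2 * ln M * p)) by ring.
  apply Rmult_le_compat_l; [lra|].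
  apply Rle_trans with (p * Z); [|exact Hpd3].
  rewrite Rmult_comm. apply Rmult_le_compat_l; [lra|]. unfold Z.
  apply Rmult_le_compat_r; [lra|]. apply Rmult_le_compat_r; [lra|].
  apply Rmult_le_compat_l; [lra|].
  assert (0 <= INR l * p) by (pose proof (pos_INR l); apply Rmult_le_pos; lra).
  apply Rmult_le_compat; lra.
Qed.

(** Again [e] is halved: [ln L] about [(C - e/2)/p] keeps the drift negative, and [exp (e / (2p))]
    absorbs the constants [4 m], [2^a] and the rounding of [l]. *)
Lemma free_energy_log_upper (e : R) :
  0 < e < / ((INR m - 1) * c0) -> exists delta, 0 < delta /\ forall p F,
    0 < p < delta -> p <= 1 -> free_energy m (mix p q) F ->
    F <= exp (- exp ((/ ((INR m - 1) * c0) - e) / p)).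
Proof.
  intros He. pose proof (INR_m_ge2 m Hm) as Hm2. pose proof ln2_bounds as Hln.
  set (beta := (INR m - 1) * c0) in *.
  assert (Hb : 0 < beta) by (apply Rmult_lt_0_compat; lra).
  set (C := / beta) in *.
  assert (HCb : beta * C = 1) by (unfold C; field; lra).
  set (u := beta * (e / 2)).
  assert (Hu : 0 < u < 1) by (unfold u; nra).
  (* Since [beta A = 1 - u], the condition of [mix_upper] has room [1 - (1 + u)(1 - u) = u^2]: one
     half for [2^(-a)], the other for [p K]. *)
  destruct (pow2_large (u * u / 2)) as [a Ha]; [nra|].
  destruct (mix_upper m q c0 Hm Hq0 Hq00 Hq1 Hc0 Hqcv u a (proj1 Hu))
    as (K & l0 & HK & H). fold beta in H.
  set (A := C - e / 2).
  assert (HA : 0 < A) by (unfold A; lra).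
  set (M := INR m) in *.
  assert (HlnM : 0 < ln M) by (rewrite <- ln_1; apply ln_increasing; lra).
  assert (Hln4M : 0 < ln (4 * M)) by (rewrite <- ln_1; apply ln_increasing; lra).
  set (kappa := ln M / (2 * 2 ^ a)).
  assert (H2a : 0 < 2 ^ a) by (apply pow_lt; lra).
  assert (Hkappa : 0 < kappa) by (apply Rdiv_lt_0_compat; lra).
  set (d1 := u * u / (2 * K)). set (d2 := A / (INR l0 + INR a + 1)).
  set (d3 := kappa * (e / 2) / (1 + ln (4 * M))).
  pose proof (pos_INR l0) as Hl0. pose proof (pos_INR a) as Ha0.
  assert (Hd1 : 0 < d1) by (apply Rdiv_lt_0_compat; nra).
  assert (Hd2 : 0 < d2) by (apply Rdiv_lt_0_compat; lra).
  assert (Hd3 : 0 < d3) by (apply Rdiv_lt_0_compat; nra).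
  exists (Rmin d1 (Rmin d2 d3)). split; [repeat apply Rmin_glb_lt; assumption|].
  intros p F [Hp Hpd] Hp1 HF.
  pose proof (Rmin_l d1 (Rmin d2 d3)). pose proof (Rmin_r d1 (Rmin d2 d3)).
  pose proof (Rmin_l d2 d3). pose proof (Rmin_r d2 d3).
  assert (Hpd1 : p * K <= u * u / 2).
  { apply Rle_trans with (d1 * K); [apply Rmult_le_compat_r; lra|].
    right. unfold d1. field. lra. }
  assert (Hpd2 : (INR l0 + INR a + 1) * p <= A).
  { apply Rle_trans with ((INR l0 + INR a + 1) * d2).
    - apply Rmult_le_compat_l; lra.
    - right. unfold d2. field. lra. }
  assert (Hpd3 : p * (1 + ln (4 * M)) <= kappa * (e / 2)).
  { apply Rle_trans with (d3 * (1 + ln (4 * M))); [apply Rmult_le_compat_r; lra|].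
    right. unfold d3. field. lra. }
  set (y := A / p).
  assert (Hpy : p * y = A) by (unfold y; field; lra).
  assert (Hyl0 : INR l0 + INR a + 1 <= y).
  { apply Rmult_le_reg_r with p; [exact Hp|]. lra. }
  destruct (nat_floor (y / ln 2)) as [l [Hl1 Hl2]].
  { apply Rlt_le, Rdiv_lt_0_compat; lra. }
  assert (Hyl : INR l * ln 2 <= y).
  { apply Rle_trans with (y / ln 2 * ln 2); [apply Rmult_le_compat_r; lra|].
    right. field. lra. }
  assert (Hyl' : y <= INR l * ln 2 + ln 2).
  { replace y with (y / ln 2 * ln 2) by (field; lra).
    replace (INR l * ln 2 + ln 2) with ((INR l + 1) * ln 2) by ring.
    apply Rmult_le_compat_r; lra. }
  assert (Hll0 : (l0 + a <= l)%nat).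
  { apply INR_le. rewrite plus_INR. pose proof (pos_INR l). nra. }
  assert (Hup : F <= 4 * M / M ^ (2 ^ (l - a))).
  { apply (H l p F ltac:(lia) (conj Hp Hp1)); [|exact HF].
    apply Rle_trans with (p * ((1 + u) * beta * y + K)).
    - apply Rmult_le_compat_l; [lra|]. apply Rplus_le_compat_r.
      apply Rmult_le_compat_l; [nra|exact Hyl].
    - replace (p * ((1 + u) * beta * y + K)) with
        ((1 + u) * (beta * (p * y)) + p * K) by ring.
      rewrite Hpy. unfold A. rewrite Rmult_minus_distr_l, HCb. fold u. nra. }
  apply Rle_trans with (1 := Hup).
  rewrite (pow_exp_ln M), INR_pow2 by lra.
  rewrite <- (exp_ln (4 * M)) at 1 by lra.
  unfold Rdiv at 1. rewrite <- exp_Ropp, <- exp_plus. apply exp_le.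
  set (E := exp ((C - e) / p)).
  assert (HE : 1 <= E).
  { unfold E. rewrite <- exp_0. apply exp_le. apply Rlt_le, Rdiv_lt_0_compat; lra. }
  (* As [E >= 1], the term [ln (4 M)] is at most [ln (4 M) E], so it can be merged into a multiple
     of [E]. *)
  assert (Hmain : (1 + ln (4 * M)) * E <= 2 ^ (l - a) * ln M); [|nra].
  assert (H2l : exp y / (2 * 2 ^ a) <= 2 ^ (l - a)).
  { apply Rmult_le_reg_r with (2 * 2 ^ a); [lra|].
    replace (exp y / (2 * 2 ^ a) * (2 * 2 ^ a)) with (exp y) by (field; lra).
    replace (2 ^ (l - a) * (2 * 2 ^ a)) with (2 ^ (l - a + a) * 2)
      by (rewrite pow_add; ring).
    replace (l - a + a)%nat with l by lia.
    rewrite pow2_exp. rewrite <- (exp_ln 2) at 2 by lra. rewrite <- exp_plus.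
    now apply exp_le. }
  apply Rle_trans with (exp y / (2 * 2 ^ a) * ln M);
    [|apply Rmult_le_compat_r; lra].
  replace (exp y / (2 * 2 ^ a) * ln M) with (kappa * exp y) by (unfold kappa; field; lra).
  replace y with ((C - e) / p + e / 2 / p) by (unfold y, A; field; lra).
  rewrite exp_plus. fold E.
  pose proof (exp_ineq1_le (e / 2 / p)) as Hexp.
  assert (Hk : 1 + ln (4 * M) <= kappa * (e / 2 / p)).
  { apply Rmult_le_reg_r with p; [exact Hp|].
    replace (kappa * (e / 2 / p) * p) with (kappa * (e / 2)) by (field; lra). lra. }
  assert (kappa * (e / 2 / p) <= kappa * exp (e / 2 / p))
    by (apply Rmult_le_compat_l; lra).
  replace (kappa * (E * exp (e / 2 / p))) with (kappa * exp (e / 2 / p) * E) by ring.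
  apply Rmult_le_compat_r; lra.
Qed.

End Asymptotics.

Theorem theorem1p3 (m : nat) (q : nat -> R) (c0 : R) :
  (2 <= m)%nat ->
  (* q is the mass function of X_0star, a random variable with values in {1,2,...} *)
  (forall k, 0 <= q k) ->
  q 0%nat = 0 ->
  infinite_sum q 1 ->
  (* P(X_0star = k) ~ c0 m^{-k} k^{-2} as k -> oo, with 0 < c0 < oo *)
  0 < c0 ->
  Un_cv (fun k => q k / (c0 * / (INR m ^ k) * / (INR k ^ 2))) 1 ->
  (* p_c(X_0star) = 0 : the free energy is (exists and is) positive for every p in (0,1] *)
  (forall p, 0 < p <= 1 ->
     exists F, free_energy m (mix p q) F /\ 0 < F) /\
  (* F_oo(p) = exp(-e^{(C+o(1))/p}) as p decreases to 0, with C = 1/((m-1) c0) *)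
  (forall eps, 0 < eps ->
     exists delta, 0 < delta /\
       forall p F, 0 < p < delta -> p <= 1 -> free_energy m (mix p q) F ->
         exists r, Rabs r < eps /\
           F = exp (- exp ((/ ((INR m - 1) * c0) + r) / p))).
Proof.
  intros Hm Hq0 Hq00 Hq1 Hc0 Hqcv. split.
  - intros p Hp.
    destruct (mix_free_energy_ex m q c0 Hm Hq0 Hq00 Hq1 Hc0 Hqcv p ltac:(lra)) as [F HF].
    exists F. split; [exact HF|].
    exact (free_energy_positive m q c0 Hm Hq0 Hq00 Hq1 Hc0 Hqcv p F Hp HF).
  - intros eps Heps. pose proof (INR_m_ge2 m Hm) as Hm2.
    set (C := / ((INR m - 1) * c0)).
    assert (HC : 0 < C) by (apply Rinv_0_lt_compat, Rmult_lt_0_compat; lra).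
    (* The bound [C / 2] keeps [C - e] positive, as the upper estimate needs; [eps / 2] makes the
       final inequality strict. *)
    set (e := Rmin (eps / 2) (C / 2)).
    assert (He : 0 < e) by (apply Rmin_glb_lt; lra).
    pose proof (Rmin_l (eps / 2) (C / 2)) as He1. fold e in He1.
    pose proof (Rmin_r (eps / 2) (C / 2)) as He2. fold e in He2.
    destruct (free_energy_log_lower m q c0 Hm Hq0 Hq00 Hq1 Hc0 Hqcv e He)
      as (d1 & Hd1 & Hlow).
    destruct (free_energy_log_upper m q c0 Hm Hq0 Hq00 Hq1 Hc0 Hqcv e ltac:(fold C; lra))
      as (d2 & Hd2 & Hupp).
    fold C in Hlow, Hupp.
    exists (Rmin d1 d2). split; [now apply Rmin_glb_lt|].
    intros p F [Hp Hpd] Hp1 HF.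
    pose proof (Rmin_l d1 d2). pose proof (Rmin_r d1 d2).
    specialize (Hlow p F ltac:(lra) Hp1 HF). specialize (Hupp p F ltac:(lra) Hp1 HF).
    assert (HF0 : 0 < F) by (apply Rlt_le_trans with (2 := Hlow); apply exp_pos).
    apply ln_le in Hlow; [|apply exp_pos]. apply ln_le in Hupp; [|exact HF0].
    rewrite ln_exp in Hlow, Hupp.
    set (L := - ln F).
    assert (HL1 : exp ((C - e) / p) <= L) by (unfold L; lra).
    assert (HL2 : L <= exp ((C + e) / p)) by (unfold L; lra).
    assert (HL0 : 0 < L) by (apply Rlt_le_trans with (2 := HL1); apply exp_pos).
    apply ln_le in HL1; [|apply exp_pos]. apply ln_le in HL2; [|exact HL0].
    rewrite ln_exp in HL1, HL2.
    (* The value of [r] is forced by solving [F = exp (- exp ((C + r) / p))]; the positivity of [F]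
       and of [- ln F], both from the two-sided bounds, makes this possible. *)
    exists (p * ln L - C). split.
    + assert (C - e <= p * ln L).
      { apply Rmult_le_compat_l with (r := p) in HL1; [|lra].
        replace (p * ((C - e) / p)) with (C - e) in HL1 by (field; lra). exact HL1. }
      assert (p * ln L <= C + e).
      { apply Rmult_le_compat_l with (r := p) in HL2; [|lra].
        replace (p * ((C + e) / p)) with (C + e) in HL2 by (field; lra). exact HL2. }
      apply Rabs_def1; lra.
    + replace ((C + (p * ln L - C)) / p) with (ln L) by (field; lra).
      rewrite exp_ln by exact HL0. unfold L.
      rewrite Ropp_involutive, exp_ln by exact HF0. reflexivity.
Qed.
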